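(* Let $d\ge1$ and $\phi\in\mathbb{R}^{d+1}\setminus S^d$. If a random vector $U$ follows the uniform distribution on $S^d$, then $\mathcal{M}_{I,\phi}(U)$ has the Cauchy distribution on the sphere $C_d^*(\phi)$.
   Context: $S^d=\{x\in\mathbb{R}^{d+1}:\|x\|=1\}$; $I$ is the $(d+1)\times(d+1)$ identity matrix. For $\phi\in\mathbb{R}^{d+1}\setminus S^d$, $C_d^*(\phi)$ is the distribution on $S^d$ with density, with respect to surface area, $$f(y;\phi)=\frac{\Gamma\{(d+1)/2\}}{2\pi^{(d+1)/2}}\left(\frac{|1-\|\phi\|^2|}{\|y-\phi\|^2}\right)^d,\quad y\in S^d.$$ For $\psi\in\mathbb{R}^{d+1}\setminus S^d$ and a rotation matrix $R$, the Möbius transformation $\mathcal{M}_{R,\psi}$ acts on $S^d$ by $$\mathcal{M}_{R,\psi}(y)=R\left\{\frac{1-\|\psi\|^2}{\|y+\psi\|^2}(y+\psi)+\psi\right\},\quad y\in S^d,$$ and maps $S^d$ onto itself. *)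

(* Defs.v *)
From HB Require Import structures.
From mathcomp Require Import all_boot all_order all_algebra.
From mathcomp Require Import all_classical all_reals all_analysis.
From mathcomp Require Import measurable_realfun.

Set Implicit Arguments.
Unset Strict Implicit.
Unset Printing Implicit Defensive.

Import Order.TTheory GRing.Theory Num.Theory.
Import numFieldNormedType.Exports.

Local Open Scope classical_set_scope.
Local Open Scope ring_scope.

(* Matrices carry the product sigma-algebra, the one making all entries
   measurable; for real entries it is the Borel sigma-algebra. *)
Definition measure_matrix_display : measure_display -> measure_display.
Proof. exact. Qed.

Section measurable_matrix.
Context {d} {T : measurableType d} (m n : nat).

Definition measurable_matrix : set (set 'M[T]_(m, n)) :=
  <<s \bigcup_(ij in [set: 'I_m * 'I_n])
        preimage_set_system setT (fun A : 'M[T]_(m, n) => A ij.1 ij.2)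
          measurable >>.

Let matrix_set0 : measurable_matrix set0.
Proof. exact: sigma_algebra0. Qed.

Let matrix_setC A : measurable_matrix A -> measurable_matrix (~` A).
Proof. exact: sigma_algebraC. Qed.

Let matrix_bigcup (F : _^nat) : (forall i, measurable_matrix (F i)) ->
  measurable_matrix (\bigcup_i (F i)).
Proof. exact: sigma_algebra_bigcup. Qed.

HB.instance Definition _ := @isMeasurable.Build (measure_matrix_display d)
  'M[T]_(m, n) measurable_matrix matrix_set0 matrix_setC matrix_bigcup.

Lemma measurable_entry (i : 'I_m) (j : 'I_n) :
  measurable_fun [set: 'M[T]_(m, n)] (fun A => A i j).
Proof.
move=> _ Y mY; rewrite setTI; apply: sub_sigma_algebra.
by exists (i, j) => //; exists Y => //; rewrite setTI.
Qed.

Lemma measurable_fun_matrix d' (T' : measurableType d')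
    (f : T' -> 'M[T]_(m, n)) :
  (forall i j, measurable_fun [set: T'] (fun t => f t i j)) ->
  measurable_fun [set: T'] f.
Proof.
move=> mf; apply: (@measurability _ _ _ _ setT f
  (\bigcup_(ij in [set: 'I_m * 'I_n])
    preimage_set_system setT (fun A : 'M[T]_(m, n) => A ij.1 ij.2)
      measurable)) => //.
move=> _ [_ [[i j] _ [B mB <-]] <-].
by rewrite !setTI -[X in measurable X]setTI; exact: (mf i j).
Qed.

End measurable_matrix.

Section lebesgue.
Context {R : realType}.

Definition vcons n (p : R * 'cV[R]_n) : 'cV[R]_n.+1 :=
  col_mx (const_mx p.1 : 'cV_1) p.2.

Definition vuncons n (v : 'cV[R]_n.+1) : R * 'cV[R]_n :=
  (v ord0 ord0, \col_i v (lift ord0 i) ord0).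

Lemma vcons0 n (p : R * 'cV[R]_n) : vcons p ord0 ord0 = p.1.
Proof.
rewrite /vcons; have -> : ord0 = lshift n (ord0 : 'I_1) :> 'I_(1 + n).
  exact: ord_inj.
by apply: etrans (col_mxEu _ _ _ _) _; rewrite mxE.
Qed.

Lemma vconsS n (p : R * 'cV[R]_n) i : vcons p (lift ord0 i) ord0 = p.2 i ord0.
Proof.
rewrite /vcons; have -> : lift ord0 i = rshift 1 i :> 'I_(1 + n).
  exact: ord_inj.
exact: col_mxEd.
Qed.

Lemma vconsK n : cancel (@vcons n) (@vuncons n).
Proof.
move=> [x v]; rewrite /vuncons vcons0; congr pair.
by apply/colP => i; rewrite mxE vconsS.
Qed.

Lemma measurable_vcons n : measurable_fun setT (@vcons n).
Proof.
apply: measurable_fun_matrix => i j; rewrite (ord1 j).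
case: (unliftP ord0 i) => [k ->|->].
  under eq_fun do rewrite vconsS.
  by apply: (measurableT_comp (measurable_entry k ord0)).
by under eq_fun do rewrite vcons0; exact: measurable_fst.
Qed.

Lemma measurable_vuncons n : measurable_fun setT (@vuncons n).
Proof.
apply: measurable_fun_pair; first exact: measurable_entry.
apply: measurable_fun_matrix => i j.
under eq_fun do rewrite mxE.
exact: measurable_entry.
Qed.

Local Open Scope ereal_scope.

Section step.
Context n (mu : {sigma_finite_measure set 'cV[R]_n -> \bar R}).

Definition lebesgue_step : set 'cV[R]_n.+1 -> \bar R :=
  pushforward (@lebesgue_measure R \x mu) (@vcons n).

Let step0 : lebesgue_step set0 = 0.
Proof. by rewrite /lebesgue_step /pushforward preimage_set0 measure0. Qed.

Let step_ge0 A : 0 <= lebesgue_step A.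
Proof. by rewrite /lebesgue_step /pushforward; exact: measure_ge0. Qed.

Let step_sigma_additive : semi_sigma_additive lebesgue_step.
Proof.
move=> F mF tF mUF; rewrite /lebesgue_step /pushforward preimage_bigcup.
apply: measure_semi_sigma_additive.
- by move=> k; rewrite -[X in measurable X]setTI; exact: measurable_vcons.
- apply/trivIsetP => /= i j _ _ ij; rewrite -preimage_setI.
  by move/trivIsetP : tF => /(_ _ _ _ _ ij) ->//; rewrite preimage_set0.
- by rewrite -preimage_bigcup -[X in measurable X]setTI; exact: measurable_vcons.
Qed.

HB.instance Definition _ := isMeasure.Build _ _ _ lebesgue_step
  step0 step_ge0 step_sigma_additive.

Let step_sigma_finite : sigma_finite setT lebesgue_step.
Proof.
have /sigma_finiteP[F [FT ndF Foo]] := sigma_finiteT (@lebesgue_measure R).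
have /sigma_finiteP[G [GT ndG Goo]] := sigma_finiteT mu.
exists (fun k => @vuncons n @^-1` (F k `*` G k)).
  rewrite -preimage_bigcup (_ : \bigcup_k _ = setT) ?preimage_setT//.
  apply/seteqP; split => // -[x y] _.
  have [i _ Fix] : (\bigcup_i F i) x by rewrite -FT.
  have [j _ Gjy] : (\bigcup_i G i) y by rewrite -GT.
  exists (maxn i j) => //; split => /=.
    by move: Fix; exact/subsetPset/ndF/leq_maxl.
  by move: Gjy; exact/subsetPset/ndG/leq_maxr.
move=> k; have [mFk Fkoo] := Foo k; have [mGk Gkoo] := Goo k; split.
  rewrite -[X in measurable X]setTI.
  by apply: measurable_vuncons => //; exact: measurableX.
rewrite /lebesgue_step /pushforward -comp_preimage.
rewrite (_ : _ \o _ = id) ?preimage_id; last first.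
  by apply/funext => p; exact: vconsK.
by rewrite product_measure1E// lte_mul_pinfty// ge0_fin_numE.
Qed.

HB.instance Definition _ := Measure_isSigmaFinite.Build _ _ _ lebesgue_step
  step_sigma_finite.

End step.

(* Lebesgue measure on R^n, as an iterated product measure. *)
Fixpoint lebesgue_cV n : {sigma_finite_measure set 'cV[R]_n -> \bar R} :=
  if n is k.+1 then lebesgue_step (lebesgue_cV k)
  else \d_(0%R : 'cV[R]_0).

End lebesgue.

Section sphere.
Context {R : realType} {n : nat}.
Implicit Types (x : 'cV[R]_n) (A : set 'cV[R]_n).

(* Euclidean norm; the norm `|x| of the library is the sup norm. *)
Definition enorm x : R := Num.sqrt (\sum_i x i ord0 ^+ 2).

Definition unit_sphere : set 'cV[R]_n := [set x | enorm x = 1].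

Lemma measurable_enorm : measurable_fun setT enorm.
Proof.
rewrite (_ : enorm = (fun y : R => y `^ 2^-1) \o
    (fun x => \sum_i x i ord0 ^+ 2)).
  apply: measurableT_comp; first exact: measurable_powR.
  by apply: measurable_sum => i; apply: measurable_funX; exact: measurable_entry.
by apply/funext => x /=; rewrite powR12_sqrt// sumr_ge0// => i _; exact: sqr_ge0.
Qed.

Definition normalize x : 'cV[R]_n := (enorm x)^-1 *: x.

Lemma measurable_normalize : measurable_fun setT normalize.
Proof.
apply: measurable_fun_matrix => i j.
under eq_fun do rewrite mxE -powR_inv1 ?sqrtr_ge0//.
apply: measurable_funM; last exact: measurable_entry.
apply: (@measurableT_comp _ _ _ _ _ _ (fun y : R => y `^ (-1))).
  exact: measurable_powR.
exact: measurable_enorm.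
Qed.

Local Open Scope ereal_scope.

(* Surface area on the unit sphere of R^n, as a Borel measure on R^n carried
   by the sphere: n times the volume of the cone over A. *)
Definition surface_area A : \bar R :=
  n%:R%:E * lebesgue_cV n [set x | (0 < enorm x <= 1)%R /\ A (normalize x)].

Let coneE A : [set x | (0 < enorm x <= 1)%R /\ A (normalize x)] =
  enorm @^-1` `]0%R, 1%R] `&` normalize @^-1` A.
Proof. by apply/seteqP; split => x /=; rewrite in_itv. Qed.

Let measurable_cone A : measurable A ->
  measurable (enorm @^-1` `]0%R, 1%R] `&` normalize @^-1` A).
Proof.
move=> mA; apply: measurableI.
  by rewrite -[X in measurable X]setTI; exact: measurable_enorm.
by rewrite -[X in measurable X]setTI; exact: measurable_normalize.
Qed.

Let surface_area0 : surface_area set0 = 0.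
Proof. by rewrite /surface_area coneE preimage_set0 setI0 measure0 mule0. Qed.

Let surface_area_ge0 A : 0 <= surface_area A.
Proof. by rewrite mule_ge0// lee_fin. Qed.

Let surface_area_sigma_additive : semi_sigma_additive surface_area.
Proof.
move=> F mF tF mUF; rewrite /surface_area.
under eq_fun.
  move=> k; under eq_bigr do rewrite coneE.
  rewrite -ge0_sume_distrr//; over.
apply: cvgeZl => //.
rewrite coneE preimage_bigcup setI_bigcupr.
apply: measure_semi_sigma_additive.
- by move=> k; exact: measurable_cone.
- apply/trivIsetP => /= i j _ _ ij; rewrite setIACA -[X in _ `&` X]preimage_setI.
  by move/trivIsetP : tF => /(_ _ _ _ _ ij) ->//; rewrite preimage_set0 setI0.
- by rewrite -setI_bigcupr -preimage_bigcup; exact: measurable_cone.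
Qed.

HB.instance Definition _ := isMeasure.Build _ _ _ surface_area
  surface_area0 surface_area_ge0 surface_area_sigma_additive.

(* Laws on the sphere are Borel measures on the ambient R^n that charge only
   the sphere. *)
Definition uniform_sphere A : \bar R :=
  (fine (surface_area unit_sphere))^-1%:E * surface_area A.

End sphere.

Section mobius.
Context {R : realType} {n : nat}.

(* Since 0^-1 = 0, [mobius] is total; when psi is off the unit sphere, the only
   degenerate argument, y = - psi, is also off the unit sphere. *)
Definition mobius (Q : 'M[R]_n) (psi y : 'cV[R]_n) : 'cV[R]_n :=
  Q *m (((1 - enorm psi ^+ 2) / enorm (y + psi) ^+ 2) *: (y + psi) + psi).

End mobius.

Section cauchy_sphere.
Context {R : realType} {d : nat}.
Implicit Types phi y : 'cV[R]_d.+1.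

Definition Gamma (a : R) : R :=
  \int[lebesgue_measure]_(t in `]0, +oo[) (t `^ (a - 1) * expR (- t)).

Definition cauchy_density phi y : R :=
  Gamma (d.+1%:R / 2) / (2 * pi `^ (d.+1%:R / 2)) *
  (`|1 - enorm phi ^+ 2| / enorm (y - phi) ^+ 2) ^+ d.

Definition cauchy_sphere phi (A : set 'cV[R]_d.+1) : \bar R :=
  (\int[surface_area]_(y in A `&` unit_sphere) (cauchy_density phi y)%:E)%E.

End cauchy_sphere.

(* The random variable X has law mu under P; measurability of X is part of the
   claim. *)
Definition has_law {d d'} {T : measurableType d} {T' : measurableType d'}
    {R : realType} (P : probability T R) (X : T -> T') (mu : set T' -> \bar R) :=
  measurable_fun setT X /\
  (forall A, measurable A -> pushforward P X A = mu A).

(* Main.v *)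
Require Import Defs.
From HB Require Import structures.
From mathcomp Require Import all_boot all_order all_algebra.
From mathcomp Require Import all_classical all_reals all_analysis.
From mathcomp Require Import measurable_realfun ring lra.

(* The Moebius transformation M of the sphere extends to the Lorentz boost
   T x = |x| k(x/|x|) M(x/|x|) of the light cone {(|x|, x)}, where
   k(y) = |y + phi|^2 / |1 - |phi|^2|, and T preserves the measure dx/|x|. By
   rotation invariance it suffices to see this for phi along the first axis; on
   lines parallel to that axis, dx/|x| is the Minkowski arc length of a hyperbola
   and T is a translation. Writing surface area as n times the volume of a cone,
   applying T and integrating in polar coordinates, the area of the preimage of
   A under M becomes the integral over A of (|1 - |phi|^2| / |y - phi|^2)^(n-1).
   The area of the whole sphere comes from the Gaussian integral. *)

Set Implicit Arguments.
Unset Strict Implicit.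
Unset Printing Implicit Defensive.

Import Order.TTheory GRing.Theory Num.Theory.
Import numFieldNormedType.Exports.

Local Open Scope classical_set_scope.
Local Open Scope ring_scope.

(** The exponent d = n - 1 arises as a difference. The condition |x| <= 1 that cuts out the cone
    contributes the power n; writing dx as |x| dx/|x|, to reach the invariant measure, brings in a
    factor |x| of degree one, which takes one power back. Both are expressed at the image point:
    k(y) is the reciprocal of |M(y) - phi|^2 / |1 - |phi|^2|, so |x| can be recovered from T x
    alone, and this is how y - phi enters the density although M is written with y + phi. No
    Jacobian is computed in n dimensions. Translations, dilations and the boost are reduced by
    Tonelli to integrals on the line, where two measures need only be compared on half-open
    intervals. Isometries are handled by uniqueness of Haar measure, and only when involutive, since
    a single reflection brings phi to the first axis. For |phi| > 1 the boost is composed with the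
    map that negates the coordinates transverse to phi; this is the origin of the sign in
    [lorentz]. *)

(** * Measures with a density, and change of variables on the line *)

Section density.
Context d (T : measurableType d) (R : realType).
Variables (mu : {measure set T -> \bar R}) (w : T -> R).
Hypotheses (mw : measurable_fun setT w) (w0 : forall x, 0 <= w x).
Local Open Scope ereal_scope.

(** The two proofs are arguments so that the term itself determines the measure structure attached
    to it below. *)
Definition mdensity of measurable_fun setT w & (forall x, 0 <= w x)%R :=
  fun A : set T => \int[mu]_(x in A) (w x)%:E.

Local Notation nu := (mdensity mw w0).

Let nu0 : nu set0 = 0. Proof. exact: integral_set0. Qed.

Let nu_ge0 A : 0 <= nu A.
Proof. by apply: integral_ge0 => x _; rewrite lee_fin. Qed.

Let nu_sigma_additive : semi_sigma_additive nu.
Proof. by apply: semi_sigma_additive_nng_induced => //; exact/measurable_EFinP. Qed.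

HB.instance Definition _ := isMeasure.Build _ _ _ nu
  nu0 nu_ge0 nu_sigma_additive.

Import HBNNSimple.

(** For the indicator of a set this is the definition of [mdensity]; linearity extends it to simple
    functions, and monotone convergence along [f_] to [f]. *)
Lemma ge0_integral_mdensity (f : T -> \bar R) :
  measurable_fun setT f -> (forall x, 0 <= f x) ->
  \int[nu]_x f x = \int[mu]_x ((w x)%:E * f x).
Proof.
move=> mf f0; have mwE : measurable_fun setT (EFin \o w) by exact/measurable_EFinP.
pose f_ := nnsfun_approx measurableT mf.
have f_cvg x : (f_ n x)%:E @[n --> \oo] --> f x by exact: cvg_nnsfun_approx.
have f_nd x : {homo (fun n => (f_ n x)%:E) : m n / (m <= n)%N >-> m <= n}.
  by move=> m n mn; rewrite lee_fin; exact/lefP/nd_nnsfun_approx.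
transitivity (limn (fun n => \int[nu]_x (f_ n x)%:E)).
  rewrite -monotone_convergence//.
  - by apply: eq_integral => x _; apply/esym/cvg_lim.
  - by move=> n; exact/measurable_EFinP/measurable_funP.
  - by move=> n x _; rewrite lee_fin.
transitivity (limn (fun n => \int[mu]_x ((w x)%:E * (f_ n x)%:E))); last first.
  rewrite -monotone_convergence//.
  - apply: eq_integral => x _; apply/cvg_lim => //.
    by apply: cvgeZl => //; exact: f_cvg.
  - by move=> n; apply: emeasurable_funM => //; exact/measurable_EFinP/measurable_funP.
  - by move=> n x _; rewrite mule_ge0// lee_fin.
  - by move=> x _ m n mn; apply: lee_wpmul2l; [rewrite lee_fin|exact: f_nd].
congr (limn _); apply/funext => n.
transitivity (\sum_(k \in range (f_ n))
    \int[nu]_x (k * \1_(f_ n @^-1` [set k]) x)%:E).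
  under eq_integral do rewrite fimfunE -fsumEFin//.
  rewrite ge0_integral_fsum//.
  - by move=> k; exact/measurable_EFinP/measurable_funM.
  - by move=> k x _; rewrite nnfun_muleindic_ge0.
transitivity (\sum_(k \in range (f_ n))
    \int[mu]_x ((w x)%:E * (k * \1_(f_ n @^-1` [set k]) x)%:E)); last first.
  rewrite -ge0_integral_fsum//.
  - apply: eq_integral => x _; rewrite -ge0_mule_fsumr.
      by rewrite fsumEFin// -fimfunE.
    by move=> k; rewrite nnfun_muleindic_ge0.
  - move=> k; apply: emeasurable_funM => //.
    exact/measurable_EFinP/measurable_funM.
  - by move=> k x _; rewrite mule_ge0 ?lee_fin// -lee_fin nnfun_muleindic_ge0.
apply: eq_fsbigr => k _; rewrite integralZl_indic_nnsfun// integral_indic// setIT.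
under [RHS]eq_integral do rewrite EFinM muleCA.
(* A negative [k] is not a value of the nonnegative [f_ n], so its level set is empty. *)
have [k0|k0] := leP 0%R k; last first.
  rewrite preimage_nnfun0// measure0 mule0 integral0_eq// => x _.
  by rewrite indic0 mule0 mule0.
rewrite ge0_integralZl//=.
- congr (_ * _); rewrite /mdensity integral_mkcond; apply: eq_integral => x _.
  by rewrite epatch_indic.
- by apply: emeasurable_funM => //; exact/measurable_EFinP.
- by move=> x _; rewrite mule_ge0 ?lee_fin.
Qed.

End density.

Section image_density.
Context {R : realType}.
Local Open Scope ereal_scope.

(** Half-open intervals form a generating system stable under intersection, and the intervals []-k,
    k]], of finite measure, exhaust the line. *)
Lemma measureR_unique (m1 m2 : {measure set (measurableTypeR R) -> \bar R}) :
  (forall a b, (a < b)%R -> m1 `]a, b]%classic = m2 `]a, b]%classic) ->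
  (forall a b, (a < b)%R -> m1 `]a, b]%classic < +oo) ->
  forall A, measurable A -> m1 A = m2 A.
Proof.
move=> m12 m1oo A mA.
apply: (@measure_unique _ R (measurableTypeR R) (@ocitv R)
  (fun k => `](- k%:R)%R, k%:R]%classic)) => //.
- exact: ocitvI.
- by move=> i; exists (- i%:R, i%:R)%R.
- apply/seteqP; split => // x _; exists (Num.bound `|x|%R) => //=.
  have := ler_norm x; have := ler_norm (- x); rewrite normrN.
  have := archi_boundP (normr_ge0 x).
  by rewrite in_itv/=; lra.
- move=> _ [[a b] _ <-]/=; have [ab|ba] := ltP a b; first exact: m12.
  by rewrite set_itv_ge ?measure0// bnd_simp -leNgt.
- move=> k; have [->|k0] := eqVneq k 0%N.
    by rewrite oppr0 set_itv_ge ?measure0 ?bnd_simp ?ltxx.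
  have : (0 < k%:R :> R)%R by rewrite ltr0n lt0n.
  by move=> k0'; apply: m1oo; lra.
Qed.

Local Notation leb := (@lebesgue_measure R).

(** A substitution rule without derivative: the image under [h] of the density [w1] is the density
    [w2] as soon as both agree on half-open intervals. Shifts, dilations, powers and the boost are
    all instances. *)
Lemma ge0_integral_image d (T : measurableType d)
    (mu : {measure set T -> \bar R}) (w1 : T -> R) (w2 : R -> R)
    (h : T -> measurableTypeR R) (f : R -> \bar R) :
  measurable_fun setT w1 -> (forall x, 0 <= w1 x)%R ->
  measurable_fun setT w2 -> (forall x, 0 <= w2 x)%R ->
  measurable_fun setT h ->
  (forall a b, (a < b)%R ->
    \int[mu]_(x in h @^-1` `]a, b]) (w1 x)%:E =
    \int[leb]_(x in `]a, b]) (w2 x)%:E) ->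
  (forall a b, (a < b)%R -> \int[leb]_(x in `]a, b]) (w2 x)%:E < +oo) ->
  measurable_fun setT f -> (forall x, 0 <= f x) ->
  \int[mu]_x ((w1 x)%:E * f (h x)) = \int[leb]_x ((w2 x)%:E * f x).
Proof.
move=> mw1 w10 mw2 w20 mh Hab Hoo mf f0.
rewrite -(ge0_integral_mdensity leb mw2 w20)//.
pose nu := mdensity mu mw1 w10.
have E A : measurable A -> pushforward nu h A = mdensity leb mw2 w20 A.
  apply: measureR_unique => // a b ab.
  by rewrite /= /pushforward /mdensity Hab// Hoo.
transitivity (\int[pushforward nu h]_x f x).
  rewrite [RHS]ge0_integral_pushforward// preimage_setT.
  rewrite [RHS]ge0_integral_mdensity//; first exact: measurableT_comp.
  by move=> x /=.
by apply: eq_measure_integral => A mA _; exact: E.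
Qed.

End image_density.

(** * Measurability of vector operations *)

Section measurable_cV.
Context {R : realType} d (T : measurableType d) (n : nat).
Implicit Types f g : T -> 'cV[R]_n.

Lemma measurable_fun_cV f : (forall i, measurable_fun setT (fun t => f t i ord0)) ->
  measurable_fun setT f.
Proof. by move=> mf; apply: measurable_fun_matrix => i j; rewrite (ord1 j). Qed.

Lemma measurable_coord f i : measurable_fun setT f ->
  measurable_fun setT (fun t => f t i ord0).
Proof. by move=> mf; exact: (measurableT_comp (measurable_entry i ord0) mf). Qed.

Lemma measurable_addv f g : measurable_fun setT f -> measurable_fun setT g ->
  measurable_fun setT (fun t => f t + g t).
Proof.
move=> mf mg; apply: measurable_fun_cV => i.
under eq_fun do rewrite mxE.
by apply: measurable_funD; exact: measurable_coord.
Qed.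

Lemma measurable_scalev (k : T -> R) f : measurable_fun setT k ->
  measurable_fun setT f -> measurable_fun setT (fun t => k t *: f t).
Proof.
move=> mk mf; apply: measurable_fun_cV => i.
under eq_fun do rewrite mxE.
by apply: measurable_funM => //; exact: measurable_coord.
Qed.

Lemma measurable_oppv f : measurable_fun setT f ->
  measurable_fun setT (fun t => - f t).
Proof.
move=> mf; apply: measurable_fun_cV => i.
under eq_fun do rewrite mxE.
by apply: measurableT_comp => //; exact: measurable_coord.
Qed.

End measurable_cV.

(** * Iterated integration on R^n, shifts and dilations of the line *)

Section iterated_integral.
Context {R : realType}.
Local Open Scope ereal_scope.
Local Notation leb := (@lebesgue_measure R).

Lemma measurable_vcons2 n (t : R) : measurable_fun setT (fun v : 'cV[R]_n => vcons (t, v)).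
Proof. exact: (measurableT_comp (@measurable_vcons R n) (pair1_measurable t)). Qed.

Lemma integral_lebesgue_cVS n (f : 'cV[R]_n.+1 -> \bar R) :
  measurable_fun setT f -> (forall x, 0 <= f x) ->
  \int[lebesgue_cV n.+1]_x f x =
  \int[leb]_t \int[lebesgue_cV n]_v f (vcons (t, v)).
Proof.
move=> mf f0.
have mv : measurable_fun [set: measurableTypeR R * 'cV[R]_n] (@vcons R n).
  exact: measurable_vcons.
transitivity (\int[leb \x lebesgue_cV n]_p f (vcons p)).
  have := ge0_integral_pushforward mv (leb \x lebesgue_cV n) measurableT mf.
  by rewrite preimage_setT; apply.
apply: (@fubini_tonelli1 _ _ _ _ _ leb (lebesgue_cV n) (f \o @vcons R n)) => //.
  exact: (measurableT_comp mf mv).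
by move=> x; exact: f0.
Qed.

Lemma measurable_integral_vcons n (f : 'cV[R]_n.+1 -> \bar R) :
  measurable_fun setT f -> (forall x, 0 <= f x) ->
  measurable_fun setT (fun t : R => \int[lebesgue_cV n]_v f (vcons (t, v))).
Proof.
move=> mf f0.
apply: (measurable_fun_fubini_tonelli_F (m2 := lebesgue_cV n) (f \o @vcons R n)) => //.
  exact: (measurableT_comp mf (@measurable_vcons R n)).
by move=> x; exact: f0.
Qed.

Lemma integral_lebesgue_cV0 (f : 'cV[R]_0 -> \bar R) :
  measurable_fun setT f -> \int[lebesgue_cV 0]_x f x = f 0%R.
Proof.
by move=> mf; rewrite [LHS]integral_dirac// diracE in_setT mul1e.
Qed.

Let integral_cstR (c : R) (D : set (measurableTypeR R)) : measurable D ->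
  \int[leb]_(x in D) (cst c x)%:E = c%:E * leb D.
Proof. by move=> mD; apply: etrans (integral_cst leb mD c%:E) _. Qed.

Lemma integral_shift (a : R) (f : R -> \bar R) :
  measurable_fun setT f -> (forall x, 0 <= f x) ->
  \int[leb]_t f (t + a)%R = \int[leb]_t f t.
Proof.
move=> mf f0.
have eq1 (g : R -> \bar R) : \int[leb]_t g t = \int[leb]_t ((cst 1 t)%:E * g t).
  by apply: eq_integral => t _; rewrite mul1e.
rewrite eq1 [RHS]eq1.
apply: (@ge0_integral_image R _ _ leb (cst 1%R) (cst 1%R)
  (fun t : R => t + a : measurableTypeR R)%R f) => //.
- by apply: measurable_funD => //.
- move=> x y xy; rewrite !integral_cstR//= ?mul1e.
    rewrite (_ : _ @^-1` _ = `](x - a)%R, (y - a)%R]%classic); last first.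
      by apply/seteqP; split=> z /=; rewrite !in_itv/= ltrBlDr lerBrDr.
    rewrite !lebesgue_measure_itv/= !lte_fin ltrD2r; case: ifP => // _.
    by congr EFin; lra.
  rewrite -[X in measurable X]setTI; apply: measurable_funD => //.
- move=> x y xy; rewrite !integral_cstR//= ?mul1e lebesgue_measure_itv/= lte_fin xy.
  by rewrite ltry.
Qed.

Lemma integral_dilation (c : R) (f : R -> \bar R) : (0 < c)%R ->
  measurable_fun setT f -> (forall x, 0 <= f x) ->
  \int[leb]_t (c%:E * f (c * t)%R) = \int[leb]_t f t.
Proof.
move=> c0 mf f0.
transitivity (\int[leb]_t ((cst 1 t)%:E * f t)); last first.
  by apply: eq_integral => t _; rewrite mul1e.
apply: (@ge0_integral_image R _ _ leb (cst c) (cst 1%R)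
  (fun t : R => c * t : measurableTypeR R)%R f) => //.
- by move=> x /=; exact: ltW.
- by apply: measurable_funM => //.
- move=> x y xy; rewrite !integral_cstR//= ?mul1e.
    rewrite (_ : _ @^-1` _ = `](x / c)%R, (y / c)%R]%classic); last first.
      by apply/seteqP; split=> z /=; rewrite !in_itv/= ltr_pdivrMr// ler_pdivlMr// mulrC.
    rewrite !lebesgue_measure_itv/= !lte_fin ltr_pM2r ?invr_gt0// xy.
    by rewrite -EFinM -mulrBl mulrCA mulfV ?mulr1// gt_eqF.
  rewrite -[X in measurable X]setTI; apply: measurable_funM => //.
- move=> x y xy; rewrite !integral_cstR//= ?mul1e lebesgue_measure_itv/= lte_fin xy.
  by rewrite ltry.
Qed.

End iterated_integral.

(** * Euclidean inner product and norm *)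

Section enorm.
Context {R : realType} (n : nat).
Implicit Types (x y : 'cV[R]_n) (k : R).

Definition dotv x y : R := \sum_i x i ord0 * y i ord0.

Lemma dotvC x y : dotv x y = dotv y x.
Proof. by apply: eq_bigr => i _; rewrite mulrC. Qed.

Lemma dotvDl x y z : dotv (x + y) z = dotv x z + dotv y z.
Proof. by rewrite -big_split; apply: eq_bigr => i _; rewrite mxE mulrDl. Qed.

Lemma dotvZl k x y : dotv (k *: x) y = k * dotv x y.
Proof. by rewrite mulr_sumr; apply: eq_bigr => i _; rewrite mxE mulrA. Qed.

Lemma dotvNl x y : dotv (- x) y = - dotv x y.
Proof. by rewrite -scaleN1r dotvZl mulN1r. Qed.

Lemma dotvDr x y z : dotv z (x + y) = dotv z x + dotv z y.
Proof. by rewrite !(dotvC z) dotvDl. Qed.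

Lemma dotvZr k x y : dotv y (k *: x) = k * dotv y x.
Proof. by rewrite !(dotvC y) dotvZl. Qed.

Lemma dotvNr x y : dotv y (- x) = - dotv y x.
Proof. by rewrite !(dotvC y) dotvNl. Qed.

Definition dotvE := (dotvDl, dotvDr, dotvZl, dotvZr, dotvNl, dotvNr).

Lemma dotvv_ge0 x : 0 <= dotv x x.
Proof. by apply: sumr_ge0 => i _; rewrite -expr2 sqr_ge0. Qed.

Lemma enormE x : enorm x = Num.sqrt (dotv x x).
Proof. by congr Num.sqrt; apply: eq_bigr => i _; rewrite expr2. Qed.

Lemma sqr_enorm x : enorm x ^+ 2 = dotv x x.
Proof. by rewrite enormE sqr_sqrtr ?dotvv_ge0. Qed.

Lemma enorm_ge0 x : 0 <= enorm x.
Proof. exact: sqrtr_ge0. Qed.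

Lemma enormZ k x : enorm (k *: x) = `|k| * enorm x.
Proof.
by rewrite !enormE !dotvE mulrA -expr2 sqrtrM ?sqr_ge0// sqrtr_sqr.
Qed.

Lemma dotvv_eq0 x : (dotv x x == 0) = (x == 0).
Proof.
apply/idP/eqP => [|->]; last by rewrite /dotv big1// => i _; rewrite mxE mul0r.
rewrite psumr_eq0 => [/allP x0|i _]; last by rewrite -expr2 sqr_ge0.
apply/colP => i; have := x0 i; rewrite mem_index_enum mxE => /(_ isT) /=.
by rewrite mulf_eq0 orbb => /eqP.
Qed.

Lemma enorm_eq0 x : (enorm x == 0) = (x == 0).
Proof. by rewrite enormE sqrtr_eq0 le_eqVlt ltNge dotvv_ge0 orbF dotvv_eq0. Qed.

Lemma enorm_gt0 x : (0 < enorm x) = (x != 0).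
Proof. by rewrite lt0r enorm_ge0 andbT enorm_eq0. Qed.

Lemma eq_enorm x (k : R) : 0 <= k -> dotv x x = k ^+ 2 -> enorm x = k.
Proof. by move=> k0 xk; rewrite enormE xk sqrtr_sqr ger0_norm. Qed.

Lemma measurable_dotv d (T : measurableType d) (f g : T -> 'cV[R]_n) :
  measurable_fun setT f -> measurable_fun setT g ->
  measurable_fun setT (fun t => dotv (f t) (g t)).
Proof.
move=> mf mg; apply: measurable_sum => i.
by apply: measurable_funM; exact: measurable_coord.
Qed.

End enorm.

Lemma dotv_vcons {R : realType} n (p q : R * 'cV[R]_n) :
  dotv (vcons p) (vcons q) = p.1 * q.1 + dotv p.2 q.2.
Proof.
rewrite /dotv big_ord_recl !vcons0; congr (_ + _).
by apply: eq_bigr => i _; rewrite !vconsS.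
Qed.

(** * Translations, dilations and the Gaussian integral on R^n *)

Section lebesgue_cV_theory.
Context {R : realType}.
Local Open Scope ereal_scope.
Local Notation leb := (@lebesgue_measure R).

Lemma vconsD n (p q : R * 'cV[R]_n) :
  vcons (p.1 + q.1, p.2 + q.2)%R = (vcons p + vcons q)%R.
Proof.
apply/colP => i; case: (unliftP ord0 i) => [k|] ->.
  by rewrite [RHS]mxE !vconsS mxE.
by rewrite [RHS]mxE !vcons0.
Qed.

Lemma vconsZ n k (p : R * 'cV[R]_n) :
  vcons (k * p.1, k *: p.2)%R = (k *: vcons p)%R.
Proof.
apply/colP => i; case: (unliftP ord0 i) => [j|] ->.
  by rewrite [RHS]mxE !vconsS mxE.
by rewrite [RHS]mxE !vcons0.
Qed.

Lemma vuncons_surj n (x : 'cV[R]_n.+1) : vcons (vuncons x) = x.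
Proof.
apply/colP => i; case: (unliftP ord0 i) => [j|] ->.
  by rewrite vconsS mxE.
by rewrite vcons0.
Qed.

Lemma integral_lebesgue_cV_shift n (a : 'cV[R]_n) (f : 'cV[R]_n -> \bar R) :
  measurable_fun setT f -> (forall x, 0 <= f x) ->
  \int[lebesgue_cV n]_x f (x + a)%R = \int[lebesgue_cV n]_x f x.
Proof.
elim: n a f => [|n IH] a f mf f0.
  rewrite !integral_lebesgue_cV0//; first by rewrite (flatmx0 a) addr0.
  by apply: (measurableT_comp mf); apply: measurable_addv.
have msh : measurable_fun setT (fun x : 'cV[R]_n.+1 => x + a)%R.
  by apply: measurable_addv.
rewrite (integral_lebesgue_cVS mf f0) integral_lebesgue_cVS; last 2 first.
- exact: (measurableT_comp mf msh).
- by move=> x; exact: f0.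
have [a0 a1 aE] : exists2 a0, True & exists a1, a = vcons (a0, a1).
  exists (vuncons a).1 => //; exists (vuncons a).2.
  by rewrite -surjective_pairing vuncons_surj.
have [b ->] := aE.
under eq_integral => t _.
  under eq_integral => v _ do rewrite -vconsD/=.
  rewrite (IH b (fun v => f (vcons (t + a0, v)%R)))//; last first.
    exact: (measurableT_comp mf (measurable_vcons2 _)).
  over.
rewrite (integral_shift a0 (f := fun t => \int[lebesgue_cV n]_v f (vcons (t, v))))//.
  exact: measurable_integral_vcons.
by move=> t; exact: integral_ge0.
Qed.

Lemma integral_lebesgue_cV_dilation n (c : R) (f : 'cV[R]_n -> \bar R) :
  (0 < c)%R -> measurable_fun setT f -> (forall x, 0 <= f x) ->
  (c ^+ n)%:E * \int[lebesgue_cV n]_x f (c *: x)%R = \int[lebesgue_cV n]_x f x.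
Proof.
move=> c0; elim: n f => [|n IH] f mf f0.
  rewrite mul1e !integral_lebesgue_cV0//; first by rewrite scaler0.
  by apply: (measurableT_comp mf); apply: measurable_scalev.
have mdi m : measurable_fun setT (fun x : 'cV[R]_m => c *: x)%R.
  by apply: measurable_scalev.
have mfc t : measurable_fun setT (fun v : 'cV[R]_n => f (vcons (t, v))).
  exact: (measurableT_comp mf (measurable_vcons2 _)).
rewrite !integral_lebesgue_cVS//; last exact: (measurableT_comp mf (mdi _)).
rewrite -(integral_dilation c0
  (f := fun t => \int[lebesgue_cV n]_v f (vcons (t, v))))//; last 2 first.
  exact: measurable_integral_vcons.
  by move=> t; exact: integral_ge0.
rewrite -ge0_integralZl; last 4 first.
- exact: measurableT.
- apply: (@measurable_integral_vcons _ _ (fun x => f (c *: x)%R)) => //.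
  exact: (measurableT_comp mf (mdi _)).
- by move=> t _; exact: integral_ge0.
- by rewrite lee_fin exprn_ge0// ltW.
apply: eq_integral => t _; rewrite -(IH (fun v => f (vcons (c * t, v)%R)))//.
rewrite exprS EFinM -muleA; congr (_ * (_ * _)); apply: eq_integral => v _.
by rewrite -vconsZ.
Qed.

(** Besides leading to the area of the sphere, it supplies a rotation invariant function of positive
    finite integral, by which extended real identities can be cancelled or bounded. *)
Lemma integral_gauss_cV n :
  \int[lebesgue_cV n]_x (expR (- dotv x x))%:E = (Num.sqrt pi ^+ n)%:E :> \bar R.
Proof.
have mg m : measurable_fun setT (fun x : 'cV[R]_m => (expR (- dotv x x))%:E).
  apply/measurable_EFinP; apply: measurableT_comp => //.
  by apply: measurableT_comp => //; apply: measurable_dotv.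
elim: n => [|n IH].
  by rewrite integral_lebesgue_cV0// /dotv big_ord0 oppr0 expR0.
rewrite integral_lebesgue_cVS; [|exact: mg|by move=> x; rewrite lee_fin expR_ge0].
under eq_integral => t _.
  under eq_integral => v _ do rewrite dotv_vcons/= opprD expRD EFinM.
  rewrite ge0_integralZl; last 4 first.
    exact: measurableT.
    exact: mg.
    by move=> v _; rewrite lee_fin expR_ge0.
    by rewrite lee_fin expR_ge0.
  rewrite IH muleC; over.
rewrite ge0_integralZl; last 4 first.
- exact: measurableT.
- apply/measurable_EFinP; apply: measurableT_comp => //.
  by apply: measurableT_comp => //; apply: measurable_funM.
- by move=> t _; rewrite lee_fin expR_ge0.
- by rewrite lee_fin exprn_ge0// sqrtr_ge0.
under eq_integral => t _ do rewrite -expr2.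
by rewrite integralT_gauss -EFinM exprSr.
Qed.

End lebesgue_cV_theory.

(** * Invariance of Lebesgue measure under involutive isometries *)

Section isometry.
Context {R : realType} (n : nat).
Local Open Scope ereal_scope.
Local Notation lam := (@lebesgue_cV R n).

Let gauss (x : 'cV[R]_n) : \bar R := (expR (- dotv x x))%:E.

Let mgauss : measurable_fun setT gauss.
Proof.
apply/measurable_EFinP; apply: measurableT_comp => //.
by apply: measurableT_comp => //; apply: measurable_dotv.
Qed.

Let gauss_ge0 x : 0 <= gauss x.
Proof. by rewrite lee_fin expR_ge0. Qed.

(* Uniqueness of Haar measure: the image of Lebesgue measure under g is
   translation invariant, so Tonelli makes it proportional to Lebesgue measure,
   and the rotation invariant Gaussian shows that the factor is 1. *)
Let integral_involutionN (g : 'cV[R]_n -> 'cV[R]_n) (G : 'cV[R]_n -> \bar R) :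
  measurable_fun setT g -> {morph g : x y / (x + y)%R} -> involutive g ->
  (forall x, dotv (g x) (g x) = dotv x x) ->
  measurable_fun setT G -> (forall x, 0 <= G x) ->
  \int[lam]_x G (g x) = \int[lam]_x G (- x)%R.
Proof.
move=> mg gD gK gE mG G0.
have gN x : g (- x)%R = (- g x)%R.
  have g0 : g 0%R = 0%R by apply: (@addrI _ (g 0%R)); rewrite -gD !addr0.
  by apply: (@addrI _ (g x)); rewrite -gD !subrr g0.
have mGg : measurable_fun setT (G \o g) by exact: measurableT_comp.
have mGN : measurable_fun setT (fun x : 'cV[R]_n => G (- x)%R).
  by apply: (measurableT_comp mG); exact: measurable_oppv.
have m1 : measurable_fun setT
    (fun p : 'cV[R]_n * 'cV[R]_n => gauss (p.2 + g p.1) * G (g p.1)).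
  apply: emeasurable_funM.
    apply: (measurableT_comp mgauss); apply: measurable_addv => //.
    exact: (measurableT_comp mg).
  exact: (measurableT_comp mGg).
have m2 : measurable_fun setT
    (fun p : 'cV[R]_n * 'cV[R]_n => gauss (g p.2) * G (g p.2 - p.1)%R).
  apply: emeasurable_funM.
    by apply: (measurableT_comp mgauss); exact: (measurableT_comp mg).
  apply: (measurableT_comp mG); apply: measurable_addv.
    exact: (measurableT_comp mg).
  exact: measurable_oppv.
have mS a : measurable_fun setT (fun x : 'cV[R]_n => gauss (x + a)%R).
  by apply: (measurableT_comp mgauss); exact: measurable_addv.
have E : \int[lam]_x gauss x * \int[lam]_x G (g x) =
         \int[lam]_x gauss x * \int[lam]_x G (- x)%R.
  transitivity (\int[lam]_y \int[lam]_x (gauss (x + g y)%R * G (g y))).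
    rewrite -ge0_integralZl; last 4 first.
    - exact: measurableT.
    - exact: mGg.
    - by move=> x _; exact: G0.
    - by apply: integral_ge0 => x _.
    apply: eq_integral => y _; rewrite ge0_integralZr; last 4 first.
    - exact: measurableT.
    - exact: mS.
    - by move=> x _; exact: gauss_ge0.
    - exact: G0.
    by rewrite integral_lebesgue_cV_shift.
  rewrite (fubini_tonelli (m1 := lam) (m2 := lam)
    (fun p => gauss (p.2 + g p.1) * G (g p.1)) m1); last first.
    by move=> p; rewrite mule_ge0.
  transitivity (\int[lam]_x \int[lam]_y (gauss (g y) * G (g y - x)%R)).
    apply: eq_integral => x _.
    (* Replacing [y] by [y - g x] turns [x + g y] into [g y], because [g (g x) = x]; the Gaussian no
       longer depends on [x]. *)
    rewrite -[LHS](integral_lebesgue_cV_shift (- g x)%R) /=; last 2 first.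
    - apply: (emeasurable_funM (f := fun y => gauss (x + g y)%R) _ mGg).
      by apply: (measurableT_comp mgauss); exact: measurable_addv.
    - by move=> y; rewrite mule_ge0.
    by apply: eq_integral => y _; rewrite gD gN gK addrC subrK addrC.
  rewrite (fubini_tonelli (m1 := lam) (m2 := lam)
    (fun p => gauss (g p.2) * G (g p.2 - p.1)%R) m2); last first.
    by move=> p; rewrite mule_ge0.
  rewrite -ge0_integralZr; last 4 first.
  - exact: measurableT.
  - exact: mgauss.
  - by move=> x _; exact: gauss_ge0.
  - by apply: integral_ge0 => x _.
  apply: eq_integral => y _ /=; rewrite ge0_integralZl; last 4 first.
  - exact: measurableT.
  - apply: (measurableT_comp mG); apply: measurable_addv => //.
    exact: measurable_oppv.
  - by move=> x _; exact: G0.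
  - exact: gauss_ge0.
  congr (_ * _); first by rewrite /gauss gE.
  (* Shifting [x] by [g y] turns [G (g y - x)] into [G (- x)], whence the sign in the conclusion. *)
  rewrite -(integral_lebesgue_cV_shift (g y)); last 2 first.
  - apply: (measurableT_comp mG); apply: measurable_addv => //.
    exact: measurable_oppv.
  - by move=> x; exact: G0.
  by apply: eq_integral => x _; rewrite opprD addrCA subrr addr0.
move: E; rewrite /gauss integral_gauss_cV; set k : R := (_ ^+ _)%R => E.
have k0 : (0 < k)%R by rewrite exprn_gt0// sqrtr_gt0 pi_gt0.
have := congr1 (fun z => (k^-1)%:E * z) E.
by rewrite !muleA -EFinM mulVf ?gt_eqF// !mul1e.
Qed.

(** The preceding lemma, applied to [g] and to [id], gives the integral of [G (- x)] in both
    cases. *)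
Lemma integral_isometry (g : 'cV[R]_n -> 'cV[R]_n) (G : 'cV[R]_n -> \bar R) :
  measurable_fun setT g -> {morph g : x y / (x + y)%R} -> involutive g ->
  (forall x, dotv (g x) (g x) = dotv x x) ->
  measurable_fun setT G -> (forall x, 0 <= G x) ->
  \int[lam]_x G (g x) = \int[lam]_x G x.
Proof.
move=> mg gD gK gE mG G0; rewrite integral_involutionN//.
by rewrite -(@integral_involutionN id).
Qed.

Lemma integral_lebesgue_cVN (G : 'cV[R]_n -> \bar R) :
  measurable_fun setT G -> (forall x, 0 <= G x) ->
  \int[lam]_x G (- x)%R = \int[lam]_x G x.
Proof. by move=> mG G0; rewrite -(@integral_involutionN id). Qed.

End isometry.

(** * Householder reflections *)

Section householder.
Context {R : realType} (n : nat).
Implicit Types v x y : 'cV[R]_n.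

(** For [v = 0] the convention [0^-1 = 0] makes this the identity, so the lemmas below need no
    condition on [v], and [phi] may already lie on the axis. *)
Definition householder v x := x - (2 * dotv v x / dotv v v) *: v.

Lemma householderD v : {morph householder v : x y / x + y}.
Proof.
move=> x y; rewrite /householder dotvDr mulrDr mulrDl scalerDl opprD.
by rewrite addrACA.
Qed.

Lemma householderZ v k x : householder v (k *: x) = k *: householder v x.
Proof.
by rewrite /householder dotvZr scalerBr scalerA; congr (_ - _ *: _); ring.
Qed.

Lemma dotv_householder v x y :
  dotv (householder v x) (householder v y) = dotv x y.
Proof.
rewrite /householder !dotvE.
have [v0|v0] := eqVneq (dotv v v) 0.
  by rewrite v0 invr0 !mulr0 !mul0r !(oppr0, addr0, mul0r).
by rewrite (dotvC x v); field.
Qed.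

Lemma householderK v : involutive (householder v).
Proof.
move=> x; rewrite /householder !dotvE.
have [v0|v0] := eqVneq (dotv v v) 0.
  by rewrite v0 invr0 !mulr0 !scale0r !subr0.
rewrite -addrA -opprD -scalerDl.
by rewrite [X in X *: v](_ : _ = 0) ?scale0r ?subr0//; field.
Qed.

Lemma measurable_householder v : measurable_fun setT (householder v).
Proof.
apply: measurable_addv => //; apply: measurable_oppv; apply: measurable_scalev => //.
apply: measurable_funM => //; apply: measurable_funM => //.
exact: measurable_dotv.
Qed.

(** Equality of the norms gives [2 * dotv (x - y) x = dotv (x - y) (x - y)], so exactly one copy of
    [x - y] is subtracted. *)
Lemma householder_swap x y : dotv x x = dotv y y -> householder (x - y) x = y.
Proof.
move=> xy; rewrite /householder.
have [v0|v0] := eqVneq (dotv (x - y) (x - y)) 0.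
  have /eqP := v0; rewrite dotvv_eq0 subr_eq0 => /eqP ->.
  by rewrite subrr scaler0 subr0.
have -> : 2 * dotv (x - y) x = dotv (x - y) (x - y).
  by rewrite !dotvE xy (dotvC y x); ring.
by rewrite divff// scale1r opprB addrC subrK.
Qed.

End householder.

Section measurable_bool.
Context {R : realType} d (T : measurableType d).

Lemma measurable_boolR (b : T -> bool) : measurable_fun setT b ->
  measurable_fun setT (fun t => (b t)%:R : R).
Proof.
move=> mb; rewrite (_ : (fun t => _) = \1_(b @^-1` [set true])).
  by apply: measurable_indic; rewrite -[X in measurable X]setTI; exact: mb.
apply/funext => t; rewrite indicE; congr (nat_of_bool _)%:R.
by apply/idP/idP; rewrite inE.
Qed.

Lemma measurable_enormT n (f : T -> 'cV[R]_n) : measurable_fun setT f ->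
  measurable_fun setT (fun t => enorm (f t)).
Proof. by move=> mf; apply: (measurableT_comp (@measurable_enorm R n)). Qed.

Lemma measurable_normalizeT n (f : T -> 'cV[R]_n) : measurable_fun setT f ->
  measurable_fun setT (fun t => normalize (f t)).
Proof. by move=> mf; apply: (measurableT_comp (@measurable_normalize R n)). Qed.

Lemma measurable_invr (f : T -> R) : measurable_fun setT f ->
  (forall t, 0 <= f t) -> measurable_fun setT (fun t => (f t)^-1).
Proof.
move=> mf f0; under eq_fun do rewrite -powR_inv1 ?f0//.
exact: (measurableT_comp (measurable_powR _) mf).
Qed.

End measurable_bool.

Section inverse_square.
Context {R : realType}.
Local Open Scope ereal_scope.
Local Notation leb := (@lebesgue_measure R).

Lemma integral_inverse_square (a : R) : (0 < a)%R ->
  \int[leb]_(s in `[a, +oo[) ((s ^+ 2)^-1)%:E = (a^-1)%:E.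
Proof.
move=> a0.
have dF (x : R) : (a <= x)%R -> is_derive x 1%R (fun s : R => - s^-1)%R ((x ^+ 2)^-1)%R.
  move=> ax; have x0 : x != 0%R by rewrite gt_eqF// (lt_le_trans a0).
  have := is_deriveN (is_deriveV x0 (is_derive_id x 1%R)).
  by rewrite scaleNr opprK /= /GRing.scale /= mulr1.
rewrite (@ge0_continuous_FTC2y R _ (fun s => - s^-1)%R a 0%R).
- by rewrite -EFinB opprK add0r.
- by move=> x ax; rewrite invr_ge0 sqr_ge0.
- apply: continuous_in_subspaceT => x; rewrite inE/= in_itv/= andbT => ax.
  apply: (@continuousV R R (fun s : R => s ^+ 2)%R x).
    by rewrite expf_neq0// gt_eqF// (lt_le_trans a0).
  exact: exprn_continuous.
- rewrite -oppr0; apply: cvgN; apply/(@gtr0_cvgV0 _ _ _ _ id); last exact: cvg_id.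
  by near=> x.
- by move=> x ax; have := dF x (ltW ax) => -[].
- apply: cvg_at_right_filter; apply: cvgN; apply: cvgV; first by rewrite gt_eqF.
  exact: cvg_id.
- move=> x; rewrite in_itv/= andbT => ax.
  by rewrite derive1E; have [_ ->] := dF x (ltW ax).
Unshelve. all: by end_near. Qed.

End inverse_square.

(** * Integration against surface area, and polar coordinates *)

Section surface_area.
Context {R : realType} (n : nat).
Local Open Scope ereal_scope.
Local Notation lam := (@lebesgue_cV R n).

Let ball (x : 'cV[R]_n) : R := (0 < enorm x <= 1)%R%:R.

Let mball : measurable_fun setT ball.
Proof.
apply: measurable_boolR; apply: measurable_and.
  by apply: measurable_fun_ltr => //; exact: measurable_enorm.
by apply: measurable_fun_ler => //; exact: measurable_enorm.
Qed.

Let ball_ge0 x : (0 <= ball x)%R.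
Proof. exact: ler0n. Qed.

(** By its definition through cones, surface area is the image under [normalize] of [n] times
    Lebesgue measure on the punctured unit ball. *)
Lemma integral_surface_area (f : 'cV[R]_n -> \bar R) :
  measurable_fun setT f -> (forall x, 0 <= f x) ->
  \int[surface_area]_y f y =
  n%:R%:E * \int[lam]_x ((0 < enorm x <= 1)%R%:R%:E * f (normalize x)).
Proof.
move=> mf f0; pose mN := @measurable_normalize R n.
have mw : measurable_fun setT (fun x => n%:R * ball x)%R.
  exact: measurable_funM.
have w0 x : (0 <= n%:R * ball x)%R by rewrite mulr_ge0.
transitivity (\int[pushforward (mdensity lam mw w0) (@normalize R n)]_y f y).
  apply: eq_measure_integral => A mA _.
  rewrite /= /pushforward /mdensity /surface_area integral_mkcond.
  pose B := [set x : 'cV[R]_n | (0 < enorm x <= 1)%R /\ A (normalize x)].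
  have mB : measurable B.
    rewrite (_ : B = (@enorm R n) @^-1` `]0%R, 1%R] `&`
        (@normalize R n) @^-1` A); last first.
      by apply/seteqP; split=> x; rewrite /B /= in_itv/=.
    apply: measurableI; rewrite -[X in measurable X]setTI; last exact: mN.
    exact: measurable_enorm.
  rewrite -[X in _ * lam X]/B -[in LHS](setIT B) -integral_indic//.
  rewrite -ge0_integralZl//; last exact/measurable_EFinP/measurable_indic.
  apply: eq_integral => x _; rewrite /patch /ball indicE.
  case: ifPn => Ax; last first.
    rewrite memNset ?mule0// => -[_ Bx]; move: Ax.
    by rewrite notin_setE.
  rewrite -EFinM; congr (_ * (nat_of_bool _)%:R)%:E.
  apply/idP/idP => [/set_mem[]//|b]; apply/mem_set; split => //.
  by move: Ax; rewrite inE.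
rewrite (ge0_integral_pushforward mN)// preimage_setT.
rewrite ge0_integral_mdensity; [|exact: measurableT_comp|by move=> x; exact: f0].
rewrite -ge0_integralZl; last 4 first.
- exact: measurableT.
- by apply: emeasurable_funM; [exact/measurable_EFinP|exact: measurableT_comp].
- by move=> x _; rewrite mule_ge0// lee_fin.
- by rewrite lee_fin.
by apply: eq_integral => x _; rewrite EFinM muleA.
Qed.

End surface_area.

Section polar.
Context {R : realType} (d : nat).
Local Open Scope ereal_scope.
Local Notation n := d.+1.
Local Notation lam := (@lebesgue_cV R n).
Local Notation leb := (@lebesgue_measure R).

Lemma normalizeZ k (x : 'cV[R]_n) : (0 < k)%R -> normalize (k *: x)%R = normalize x.
Proof.
move=> k0; rewrite /normalize enormZ gtr0_norm// invfM scalerA.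
by rewrite mulrAC mulVf ?mul1r// gt_eqF.
Qed.

(** The radial variable [u] stands for |x|^n rather than |x|: as n r^(n-1) dr = du, the polar
    formula then carries no Jacobian. *)
Variable F : measurableTypeR R * 'cV[R]_n -> \bar R.
Hypotheses (mF : measurable_fun setT F) (F0 : forall p, 0 <= F p).
Hypothesis FN : forall u y, (u <= 0)%R -> F (u, y) = 0.

Let m1 : measurable_fun setT (fun y : 'cV[R]_n => \int[leb]_u F (u, y)).
Proof. exact: (measurable_fun_fubini_tonelli_G (m1 := leb) F mF F0). Qed.

Let b (x : 'cV[R]_n) : R := (0 < enorm x <= 1)%R%:R.

Let mb : measurable_fun setT b.
Proof.
apply: measurable_boolR; apply: measurable_and.
  by apply: measurable_fun_ltr => //; exact: measurable_enorm.
by apply: measurable_fun_ler => //; exact: measurable_enorm.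
Qed.

Let G (p : measurableTypeR R * 'cV[R]_n) : \bar R :=
  (b p.2 * enorm p.2 ^+ n)%:E * F (p.1 * enorm p.2 ^+ n, normalize p.2)%R.

Let mG : measurable_fun setT G.
Proof.
have mp2 : measurable_fun [set: measurableTypeR R * 'cV[R]_n] (fun p => enorm p.2 ^+ n)%R.
  by apply: measurable_funX; exact: measurable_enormT.
apply: emeasurable_funM.
  apply/measurable_EFinP; apply: measurable_funM => //.
  exact: (measurableT_comp mb).
apply: (measurableT_comp mF); apply: measurable_fun_pair.
  by apply: measurable_funM => //; exact: measurable_fst.
exact: measurable_normalizeT.
Qed.

Let G0 p : 0 <= G p.
Proof. by rewrite mule_ge0// lee_fin mulr_ge0 ?ler0n// exprn_ge0// enorm_ge0. Qed.

Let K (p : measurableTypeR R * 'cV[R]_n) : \bar R :=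
  ((0 < p.1)%R%:R * (0 < enorm p.2 ^+ n <= p.1)%R%:R * (p.1 ^+ 2)^-1 * enorm p.2 ^+ n)%:E *
  F (enorm p.2 ^+ n, normalize p.2)%R.

Let mK : measurable_fun setT K.
Proof.
have mp2 : measurable_fun [set: measurableTypeR R * 'cV[R]_n] (fun p => enorm p.2 ^+ n)%R.
  by apply: measurable_funX; exact: measurable_enormT.
have mp1 : measurable_fun [set: measurableTypeR R * 'cV[R]_n] fst by exact: measurable_fst.
apply: emeasurable_funM.
  apply/measurable_EFinP; apply: measurable_funM => //.
  apply: measurable_funM => //.
    apply: measurable_funM; apply: measurable_boolR.
      exact: measurable_fun_ltr.
    by apply: measurable_and; [exact: measurable_fun_ltr|exact: measurable_fun_ler].
  apply: measurable_invr => [|p]; last exact: sqr_ge0.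
  exact: measurable_funX.
apply: (measurableT_comp mF); apply: measurable_fun_pair => //.
exact: measurable_normalizeT.
Qed.

Let K0 p : 0 <= K p.
Proof.
rewrite mule_ge0// lee_fin !mulr_ge0 ?ler0n// ?invr_ge0 ?sqr_ge0//.
by rewrite exprn_ge0// enorm_ge0.
Qed.

Let GK s : \int[lam]_x G (s, x) = \int[lam]_x K (s, x).
Proof.
have [s0|s0] := leP s 0%R.
  rewrite !integral0_eq// => x _.
    by rewrite /K /= ltNge s0 !mul0r mul0e.
  by rewrite /G /= FN ?mule0// mulr_le0_ge0// exprn_ge0// enorm_ge0.
pose c : R := ((s : R) `^ (n%:R^-1))%R.
have c0 : (0 < c)%R by exact: powR_gt0.
have cn : (c ^+ n = s)%R.
  by rewrite -powR_mulrn ?ltW// -powRrM mulVf ?pnatr_eq0// powRr1 ?ltW.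
rewrite -[RHS](integral_lebesgue_cV_dilation c0); last 2 first.
- apply: (measurableT_comp mK); exact: measurable_fun_pair.
- by move=> x; exact: K0.
rewrite cn -ge0_integralZl; last 4 first.
- exact: measurableT.
- apply: (measurableT_comp mK); apply: measurable_fun_pair => //.
  exact: measurable_scalev.
- by move=> x _; exact: K0.
- by rewrite lee_fin ltW.
apply: eq_integral => x _; rewrite /G /K /= muleA -EFinM.
congr (_%:E * F (_, _)); last 2 first.
- by rewrite enormZ gtr0_norm// exprMn cn.
- by rewrite normalizeZ.
- rewrite enormZ gtr0_norm// exprMn cn s0 mul1r.
  rewrite pmulr_rgt0// -[X in (_ <= X)%R]mulr1 ler_pM2l//.
  rewrite expr_le1 ?enorm_ge0// /b !lt0r expf_eq0/= exprn_ge0 ?enorm_ge0//=.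
  by field; rewrite gt_eqF.
Qed.

(* Expanding the surface integral over the cone and setting u = s |x|^n gives
   the integral of G over pairs (s, x). For fixed s, the dilation by s^(1/n)
   turns G into K, and then the integral of s^-2 over [|x|^n, +oo[ is all that
   is left of s. *)
Lemma integral_polar : \int[surface_area]_y \int[leb]_u F (u, y) =
  n%:R%:E * \int[lam]_x F ((enorm x) ^+ n, normalize x)%R.
Proof.
rewrite integral_surface_area//; last first.
  by move=> y; apply: integral_ge0 => u _; exact: F0.
congr (_ * _).
transitivity (\int[lam]_x \int[leb]_s G (s, x)).
  apply: eq_integral => x _; rewrite /G /=.
  have [x01|] := boolP (0 < enorm x <= 1)%R; last first.
    move=> /negbTE x01; rewrite mul0e integral0_eq// => s _.
    by rewrite /b x01 mul0r mul0e.
  have a0 : (0 < enorm x ^+ n)%R by case/andP: x01 => ? _; exact: exprn_gt0.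
  rewrite mul1e -[LHS](integral_dilation a0); last 2 first.
  - exact: (measurableT_comp mF (pair2_measurable _)).
  - by move=> u; exact: F0.
  by apply: eq_integral => s _; rewrite /b x01 mul1r mulrC.
rewrite -(fubini_tonelli (m1 := leb) (m2 := lam) G mG G0).
under eq_integral do rewrite GK.
rewrite (fubini_tonelli (m1 := leb) (m2 := lam) K mK K0).
apply: eq_integral => x _; rewrite /K /=.
have [x0|x0] := eqVneq (enorm x) 0%R.
  rewrite FN ?x0 ?expr0n// integral0_eq// => s _.
  by rewrite mule0.
have a0 : (0 < enorm x ^+ n)%R by rewrite exprn_gt0// lt0r x0 enorm_ge0.
set a := (enorm x ^+ n)%R in a0 *.
transitivity (\int[leb]_(s in `[a, +oo[)
    (((s ^+ 2)^-1)%:E * (a%:E * F (a, normalize x)))).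
  rewrite [RHS]integral_mkcond; apply: eq_integral => s _ /=.
  rewrite a0 patchE; case: ifPn => [|/negP]; rewrite inE/= in_itv/= andbT.
    by move=> as_; rewrite as_ (lt_le_trans a0 as_) !mul1r EFinM muleA.
  by move=> /negP/negbTE ->; rewrite mulr0 !mul0r mul0e.
rewrite ge0_integralZr; last 4 first.
- exact: measurable_itv.
- apply/measurable_EFinP; apply: measurable_funTS.
  apply: measurable_invr => [|s]; last exact: sqr_ge0.
  exact: measurable_funX.
- by move=> s _; rewrite lee_fin invr_ge0 sqr_ge0.
- by rewrite mule_ge0// lee_fin ltW.
by rewrite integral_inverse_square// muleA -EFinM mulVf ?gt_eqF// mul1e.
Qed.

End polar.

(** * The substitution u = t^p on the half-line *)

Section power_substitution.
Context {R : realType}.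
Local Open Scope ereal_scope.
Local Notation leb := (@lebesgue_measure R).

Lemma powR_cvg (q a : R) : (0 < a)%R -> (x `^ q)%R @[x --> a] --> (a `^ q)%R.
Proof.
move=> a0; suff : {for a, continuous (@powR R ^~ q)} by [].
apply/differentiable_continuous/derivable1_diffP.
by apply: derivable_powR; rewrite in_itv/= a0.
Qed.

Lemma powR_cvg_at_right (q a : R) : (0 <= q)%R -> (0 <= a)%R ->
  (x `^ q)%R @[x --> a^'+] --> (a `^ q)%R.
Proof.
move=> q0; rewrite le_eqVlt => /predU1P[<-|a0].
  have [->|qn0] := eqVneq q 0%R.
    rewrite (_ : (fun x => _) = cst 1%R); last by apply/funext => x; rewrite powRr0.
    by rewrite powRr0; exact: cvg_cst.
  by rewrite powR0//; apply: powR_cvg0; rewrite lt0r qn0.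
by apply: cvg_at_right_filter; exact: powR_cvg.
Qed.

Lemma integral_powR (p a b : R) : (1 <= p)%R -> (0 <= a)%R -> (a < b)%R ->
  \int[leb]_(t in `[a, b]) ((t `^ (p - 1))%R)%:E =
  (p^-1 * (b `^ p - a `^ p))%R%:E.
Proof.
move=> p1 a0 ab.
have p0 : (0 < p)%R by rewrite (lt_le_trans ltr01).
have q0 : (0 <= p - 1)%R by rewrite subr_ge0.
have b0 : (0 < b)%R by rewrite (le_lt_trans a0).
rewrite (@continuous_FTC2 R _ (fun t => p^-1 * t `^ p)%R)//.
- by rewrite -EFinB mulrBr.
- apply/continuous_within_itvP => //; split.
  + move=> x; rewrite in_itv/= => /andP[ax _]; apply: powR_cvg.
    exact: le_lt_trans ax.
  + exact: powR_cvg_at_right.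
  + by apply: cvg_at_left_filter; exact: powR_cvg.
- split.
  + move=> x; rewrite in_itv/= => /andP[ax _]; apply: derivableM => //.
    by apply: derivable_powR; rewrite in_itv/= (le_lt_trans a0).
  + apply: cvgM; first exact: cvg_cst.
    by apply: powR_cvg_at_right => //; exact: ltW.
  + apply: cvgM; first exact: cvg_cst.
    by apply: cvg_at_left_filter; exact: powR_cvg.
- move=> x; rewrite in_itv/= => /andP[ax _].
  have x0 : (0 < x)%R by exact: le_lt_trans ax.
  rewrite derive1E; have := is_deriveZ p^-1 (is_derive1_powR p x0).
  move=> [_]; rewrite /GRing.scale/= mulrA mulVf ?gt_eqF// mul1r => <-.
  by [].
Qed.

(** The indicators remove the part of the line where [powR] only has default values. The bound on
    [p] keeps [t ^ (p - 1)] continuous down to 0, so that the fundamental theorem of calculus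
    applies on intervals starting at 0. *)
Lemma integral_powR_subst (p : R) (f : R -> \bar R) : (1 <= p)%R ->
  measurable_fun setT f -> (forall x, 0 <= f x) ->
  \int[leb]_u (((0 < u)%R%:R * p^-1)%:E * f (u `^ p^-1)%R) =
  \int[leb]_t (((0 < t)%R%:R * t `^ (p - 1))%:E * f t).
Proof.
move=> p1 mf f0; have p0 : (0 < p)%R by rewrite (lt_le_trans ltr01).
have mpos : measurable_fun setT (fun u : R => (0 < u)%R%:R : R).
  by apply: measurable_boolR; exact: measurable_fun_ltr.
(* The integrand vanishes on the nonpositive half-line, so the left end can be raised to
   [Num.max a 0]. The alternative [b <= a] is refuted at each use. *)
have K2 (a b : R) : (0 < b)%R ->
    \int[leb]_(x in `]a, b]) ((0 < x)%R%:R * x `^ (p - 1))%:E =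
    (p^-1 * (b `^ p - Num.max a 0 `^ p))%R%:E \/ (b <= a)%R.
  move=> b0; have [|ab] := leP b a; [by right|left].
  rewrite -integral_powR ?le_max ?lexx ?orbT// ?gt_max ?ab//.
  rewrite -integral_itv_obnd_cbnd; last first.
    by apply/measurable_EFinP; apply: measurable_funTS; exact: measurable_powR.
  rewrite integral_mkcond [RHS]integral_mkcond; apply: eq_integral => x _.
  rewrite !patchE; have [x0|x0] := ltP 0%R x.
    by rewrite mul1r !(mem_setE) !in_itv/= gt_max x0 andbT.
  rewrite mul0r if_same memNset//= in_itv/= gt_max.
  by rewrite (ltNge 0%R) x0 andbF.
apply: (@ge0_integral_image R _ _ leb (fun u => (0 < u)%R%:R * p^-1)%R
  (fun t => (0 < t)%R%:R * t `^ (p - 1))%R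
  (fun u : R => (u `^ p^-1)%R : measurableTypeR R) f) => //.
- by apply: measurable_funM.
- by move=> x; rewrite mulr_ge0 ?ler0n// invr_ge0 ltW.
- by apply: measurable_funM => //; exact: measurable_powR.
- by move=> x; rewrite mulr_ge0 ?ler0n// powR_ge0.
- move=> a b ab; have [b0|b0] := leP b 0%R.
    rewrite !integral0_eq// => x; rewrite /= in_itv/= => /andP[ax xb].
      by rewrite ltNge (le_trans xb b0) mul0r.
    have [x0|] := ltP 0%R x; last by rewrite mul0r.
    by move: xb; rewrite leNgt (le_lt_trans b0)// powR_gt0.
  have [->|] := K2 a b b0; last by rewrite leNgt ab.
  set a' := Num.max a 0%R.
  have a'0 : (0 <= a')%R by rewrite le_max lexx orbT.
  have a'b : (a' < b)%R by rewrite gt_max ab.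
  transitivity (\int[leb]_(u in `](a' `^ p)%R, (b `^ p)%R]) (p^-1)%:E).
    rewrite integral_mkcond [RHS]integral_mkcond; apply: eq_integral => u _.
    rewrite !patchE; have [u0|u0] := ltP 0%R u; last first.
      rewrite mul0r if_same memNset//= in_itv/= ltNge.
      by rewrite (le_trans u0) ?powR_ge0.
    have -> : (u \in (@powR R)^~ p^-1%R @^-1` `]a, b]%classic) =
        (a < u `^ p^-1 <= b)%R.
      by apply/idP/idP; rewrite inE/= in_itv.
    rewrite mul1r !mem_setE /= !in_itv/=.
    set v := (u `^ p^-1)%R.
    have v0 : (0 < v)%R by exact: powR_gt0.
    have -> : u = (v `^ p)%R by rewrite -powRrM mulVf ?gt_eqF// powRr1// ltW.
    have av : (a < v)%R = (a' < v)%R by rewrite gt_max v0 andbT.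
    have mono (x y : R) : (0 <= x)%R -> (0 <= y)%R -> (x `^ p < y `^ p)%R = (x < y)%R.
      move=> x0 y0; apply/idP/idP => [|xy]; last by apply: gt0_ltr_powR.
      rewrite !ltNge; apply: contra => yx.
      by apply: ge0_ler_powR => //; exact: ltW.
    rewrite av mono ?(ltW v0)// [in RHS]leNgt mono ?(ltW v0) ?(ltW b0)//.
    by rewrite -leNgt.
  rewrite integral_cst//= lebesgue_measure_itv/= lte_fin ifT ?EFinB//.
  by apply: gt0_ltr_powR => //; rewrite nnegrE ltW.
- move=> a b ab; have [b0|b0] := leP b 0%R.
    rewrite integral0_eq ?ltry// => x; rewrite /= in_itv/= => /andP[ax xb].
    by rewrite ltNge (le_trans xb b0) mul0r.
  by have [->|] := K2 a b b0; [rewrite ltry|rewrite leNgt ab].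
Qed.

End power_substitution.

(** * The origin is negligible; total area of the sphere *)

Section sphere_area.
Context {R : realType} (d : nat).
Local Open Scope ereal_scope.
Local Notation n := d.+1.
Local Notation lam := (@lebesgue_cV R n).
Local Notation leb := (@lebesgue_measure R).

Let mgauss : measurable_fun setT (fun x : 'cV[R]_n => (expR (- dotv x x))%:E).
Proof.
apply/measurable_EFinP; apply: measurableT_comp => //.
by apply: measurableT_comp => //; apply: measurable_dotv.
Qed.

Lemma measurable_origin : measurable [set x : 'cV[R]_n | enorm x = 0%R].
Proof.
rewrite (_ : [set x | _] = @enorm R n @^-1` [set 0%R])//.
by rewrite -[X in measurable X]setTI; exact: measurable_enorm.
Qed.

(* The origin is invariant under dilations, which multiply volumes. *)
Lemma lebesgue_cV_origin : lam [set x | enorm x = 0%R] = 0.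
Proof.
set O := [set _ | _]; have mO : measurable O := measurable_origin.
have ind x : (\1_O x : R) = (enorm x == 0%R)%:R.
  by rewrite indicE; congr (nat_of_bool _)%:R; apply/idP/eqP; rewrite inE.
have mi : measurable_fun setT (fun x => (\1_O x)%:E : \bar R).
  exact/measurable_EFinP/measurable_indic.
have i0 x : 0 <= (\1_O x)%:E :> \bar R by rewrite lee_fin.
have iE : \int[lam]_x (\1_O x)%:E = lam O by rewrite integral_indic// setIT.
have := @integral_lebesgue_cV_dilation R n 2 (fun x => (\1_O x)%:E) (ltr0n _ 2) mi i0.
have -> : \int[lam]_x (\1_O (2 *: x)%R)%:E = \int[lam]_x (\1_O x)%:E.
  by apply: eq_integral => x _; rewrite !ind enormZ mulf_eq0 normr_eq0 pnatr_eq0.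
rewrite iE.
(* Dilation by 2 gives [2 ^+ n * lam O = lam O]; to conclude, [lam O] must be finite. The Gaussian
   equals 1 at the origin and so dominates the indicator. *)
have : lam O \is a fin_num.
  rewrite ge0_fin_numE ?measure_ge0// -iE.
  apply: (@le_lt_trans _ _ (\int[lam]_x (expR (- dotv x x))%:E)).
    apply: ge0_le_integral => // x _.
    rewrite lee_fin ind; case: eqP => [x0|_]; last exact: expR_ge0.
    by rewrite -sqr_enorm x0 expr0n/= oppr0 expR0.
  by rewrite integral_gauss_cV ltry.
move=> /fineK <-; rewrite -EFinM => -[/eqP].
rewrite -subr_eq0 -[X in (_ - X)%R]mul1r -mulrBl mulf_eq0 => /orP[|/eqP ->//].
by rewrite subr_eq0 pexpr_eq1// pnatr_eq1.
Qed.

Lemma eq_integral_off0 (f g : 'cV[R]_n -> \bar R) :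
  measurable_fun setT f -> measurable_fun setT g ->
  (forall x, 0 <= f x) -> (forall x, 0 <= g x) ->
  (forall x, x != 0%R -> f x = g x) ->
  \int[lam]_x f x = \int[lam]_x g x.
Proof.
move=> mf mg f0 g0 fg; apply: ge0_ae_eq_integral => //.
exists [set x | enorm x = 0%R]; split.
- exact: measurable_origin.
- exact: lebesgue_cV_origin.
- move=> x /= fgx; apply: contrapT => /eqP; rewrite enorm_eq0 => /fg E.
  by apply: fgx => _; exact: E.
Qed.

Lemma enorm_normalize (x : 'cV[R]_n) : x != 0%R -> enorm (normalize x) = 1%R.
Proof.
rewrite -enorm_eq0 => x0.
by rewrite /normalize enormZ ger0_norm ?invr_ge0 ?enorm_ge0// mulVf.
Qed.

Lemma measurable_unit_sphere : measurable (@unit_sphere R n).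
Proof.
rewrite (_ : unit_sphere = @enorm R n @^-1` [set 1%R])//.
by rewrite -[X in measurable X]setTI; exact: measurable_enorm.
Qed.

Lemma surface_areaI_sphere (A : set 'cV[R]_n) :
  surface_area (A `&` unit_sphere) = surface_area A.
Proof.
congr (_ * lam _); apply/seteqP; split=> x /= [x01 Ax]; split=> //.
  by case: Ax.
split => //; apply: enorm_normalize.
by rewrite -enorm_gt0; case/andP: x01.
Qed.

Let p : R := n%:R / 2.

(** [Gamma] is the [fine] part of this integral, which would be 0 if it diverged. Working in the
    extended reals postpones convergence until it follows from the area formula. *)
Definition Gamma_integral (a : R) : \bar R :=
  \int[leb]_t (((0 < t)%R%:R * t `^ (a - 1))%:E * (expR (- t))%:E).

Lemma GammaE (a : R) : Gamma a = fine (Gamma_integral a).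
Proof.
rewrite /Gamma /Rintegral /Gamma_integral integral_mkcond; congr fine.
apply: eq_integral => t _; rewrite patchE mem_setE in_itv/= andbT -EFinM.
by case: ifP => _; rewrite ?mul1r// !mul0r.
Qed.

(** The Gaussian integral is evaluated in polar coordinates: its value [Num.sqrt pi ^+ n],
    multiplied by [n], equals the area times [p * Gamma_integral p], and [n / p = 2]. *)
Lemma surface_area_sphere_Gamma : (1 <= d)%N ->
  @surface_area R n unit_sphere * Gamma_integral p = (2 * pi `^ p)%:E.
Proof.
move=> d1.
have p1 : (1 <= p)%R by rewrite /p ler_pdivlMr// mul1r ler_nat.
have p0 : (0 < p)%R by rewrite (lt_le_trans ltr01).
have me : measurable_fun setT (fun t : R => (expR (- t))%:E).
  by apply/measurable_EFinP; apply: measurableT_comp => //; exact: measurableT_comp.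
(* With u = |x|^n and [p = n / 2], the power u^(1/p) is |x|^2, so [F] is the Gaussian in polar
   coordinates. *)
pose F (q : measurableTypeR R * 'cV[R]_n) : \bar R :=
  ((0 < (q.1 : R))%R%:R)%:E * (expR (- ((q.1 : R) `^ p^-1)))%:E.
have mF : measurable_fun setT F.
  apply: emeasurable_funM.
    apply/measurable_EFinP; apply: measurable_boolR.
    by apply: measurable_fun_ltr => //; exact: measurable_fst.
  apply: (measurableT_comp me).
  exact: (measurableT_comp (measurable_powR _) measurable_fst).
have F0 q : 0 <= F q by rewrite mule_ge0 ?lee_fin ?expR_ge0.
have FN (u : R) y : (u <= 0)%R -> F (u, y) = 0.
  by rewrite leNgt /F /= => /negbTE ->; rewrite mul0e.
have := integral_polar mF F0 FN.
have -> : \int[lam]_x F ((enorm x ^+ n)%R, normalize x) = (Num.sqrt pi ^+ n)%:E.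
  rewrite -integral_gauss_cV; apply: eq_integral_off0.
  - apply: (measurableT_comp mF); apply: measurable_fun_pair.
      by apply: measurable_funX; exact: measurable_enorm.
    exact: measurable_normalize.
  - exact: mgauss.
  - by move=> x; exact: F0.
  - by move=> x; rewrite lee_fin expR_ge0.
  - move=> x x0; rewrite /F /= exprn_gt0 ?enorm_gt0// mul1e.
    rewrite -powR_mulrn ?enorm_ge0// -powRrM /p invf_div mulrCA mulfV ?pnatr_eq0//.
    by rewrite mulr1 powR_mulrn ?enorm_ge0// sqr_enorm.
have -> : \int[surface_area]_y \int[leb]_u F (u, y) =
    surface_area (@unit_sphere R n) * (p%:E * Gamma_integral p).
  rewrite -[unit_sphere]setTI surface_areaI_sphere [RHS]muleC.
  rewrite -(@integral_cst _ _ _ surface_area _ measurableT); apply: eq_integral => y _ /=.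
  rewrite /Gamma_integral -integral_powR_subst//.
  rewrite -ge0_integralZl; last 4 first.
  - exact: measurableT.
  - apply: emeasurable_funM; last first.
      apply: (measurableT_comp me); exact: measurable_powR.
    apply/measurable_EFinP; apply: measurable_funM => //; apply: measurable_boolR.
    exact: measurable_fun_ltr.
  - move=> u _; apply: mule_ge0; rewrite lee_fin ?expR_ge0//.
    by rewrite mulr_ge0// invr_ge0 ltW.
  - by rewrite lee_fin ltW.
  apply: eq_integral => u _; rewrite /F /= muleA; congr (_ * _); rewrite -EFinM; congr EFin.
  by rewrite mulrCA mulfV ?gt_eqF// mulr1.
move=> E.
have := congr1 (fun z => (p^-1)%:E * z) E.
rewrite /= muleCA (muleA (p^-1)%:E p%:E) -[(p^-1)%:E * p%:E]EFinM.
rewrite mulVf ?gt_eqF// mul1e => ->; rewrite -!EFinM; congr EFin.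
rewrite mulrA; congr (_ * _)%R; first by rewrite /p invf_div divfK ?pnatr_eq0.
by rewrite -powR12_sqrt ?pi_ge0// -powR_mulrn ?powR_ge0// -powRrM mulrC.
Qed.

(** Two nonnegative extended reals whose product is finite and positive are themselves finite and
    nonzero ([0 * +oo] is 0, hence excluded), so [fine] loses nothing on either factor. *)
Lemma surface_area_sphere : (1 <= d)%N ->
  ((fine (@surface_area R n unit_sphere))^-1 = Gamma p / (2 * pi `^ p))%R.
Proof.
move=> /surface_area_sphere_Gamma; rewrite GammaE.
have : 0 <= Gamma_integral p.
  apply: integral_ge0 => t _; apply: mule_ge0; rewrite lee_fin ?expR_ge0//.
  by rewrite mulr_ge0 ?powR_ge0.
have : 0 <= surface_area (@unit_sphere R n) by exact: measure_ge0.
have c0 : (0 < 2 * pi `^ p :> R)%R by rewrite mulr_gt0// powR_gt0// pi_gt0.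
case: (surface_area _) => [s| |]// s0; case: (Gamma_integral p) => [g| |]// g0.
- rewrite -EFinM => -[E] /=.
  have sg0 : (s * g != 0)%R by rewrite E gt_eqF.
  move: sg0; rewrite mulf_eq0 negb_or => /andP[sn0 gn0].
  by rewrite -E; field; rewrite sn0 gn0.
- have [->|sn0] := eqVneq s 0%R.
    by rewrite mul0e => -[E]; move: c0; rewrite -E ltxx.
  by rewrite gt0_muley// lte_fin lt0r sn0.
- have [->|gn0] := eqVneq g 0%R.
    by rewrite mule0 => -[E]; move: c0; rewrite -E ltxx.
  by rewrite gt0_mulye// lte_fin lt0r gn0.
Qed.

End sphere_area.

(** * The boost on a line parallel to the axis *)

Section hyperbolic_rotation.
Context {R : realType} (rho c s : R).
Hypotheses (rho0 : 0 < rho) (c0 : 0 < c) (cs : c ^+ 2 - s ^+ 2 = 1).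
Local Notation leb := (@lebesgue_measure R).

(** The norm of a point with first coordinate [t] at distance [rho] from the axis; [c] and [s] act
    as hyperbolic cosine and sine. *)
Let r (t : R) : R := Num.sqrt (t ^+ 2 + rho ^+ 2).

Let sqr_r t : r t ^+ 2 = t ^+ 2 + rho ^+ 2.
Proof. by rewrite sqr_sqrtr// addr_ge0// sqr_ge0. Qed.

Let r_gt0 t : 0 < r t.
Proof. by rewrite sqrtr_gt0 ltr_wpDl ?sqr_ge0// exprn_gt0. Qed.

Let ltr_norm_r t : `|t| < r t.
Proof.
by rewrite -(@ltr_pXn2r _ 2) ?nnegrE// ?ltW// sqr_r real_normK ?num_real// ltrDl exprn_gt0.
Qed.

Let rt_gt0 t : 0 < t + r t.
Proof. by have := ltr_norm_r t; rewrite ltr_norml => /andP[]; lra. Qed.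

Let norm_s : `|s| < c.
Proof.
rewrite -(@ltr_pXn2r _ 2) ?nnegrE// ?ltW// real_normK ?num_real//.
by rewrite -subr_gt0 cs.
Qed.

(** The boost preserves the form r^2 - t^2, and [|s'| < c] makes the right-hand side positive, which
    selects the root. A generic [s'] covers both [s] and the inverse boost [- s]. *)
Let boost_r s' t : c ^+ 2 - s' ^+ 2 = 1 -> `|s'| < c ->
  r (c * t + s' * r t) = c * r t + s' * t.
Proof.
move=> cs' s'c; have p0 : 0 < c * r t + s' * t.
  have : `|s' * t| < c * r t.
    rewrite normrM; apply: (@le_lt_trans _ _ (`|s'| * r t)).
      by rewrite ler_wpM2l// ltW.
    by rewrite ltr_pM2r.
  by rewrite ltr_norml => /andP[]; lra.
rewrite [LHS]/r (_ : _ + _ = (c * r t + s' * t) ^+ 2).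
  by rewrite sqrtr_sqr gtr0_norm.
have := sqr_r t; set q := r t => qE.
have : (c * q + s' * t) ^+ 2 - (c * t + s' * q) ^+ 2 =
    (c ^+ 2 - s' ^+ 2) * (q ^+ 2 - t ^+ 2) by ring.
by rewrite cs' mul1r qE; lra.
Qed.

Let boostK s' t : c ^+ 2 - s' ^+ 2 = 1 -> `|s'| < c ->
  let u := c * t + s' * r t in c * u - s' * r u = t.
Proof.
move=> cs' s'c /=; rewrite boost_r//.
by rewrite -[RHS]mul1r -cs'; ring.
Qed.

(** [r] is 1-Lipschitz, so the term [s' * r t] cannot outweigh [c * t]. *)
Let boost_homo s' : `|s'| < c ->
  {homo (fun t => c * t + s' * r t) : x y / x < y}.
Proof.
move=> s'c x y xy.
have : `|r y - r x| <= y - x.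
  rewrite -(ler_pM2r (addr_gt0 (r_gt0 x) (r_gt0 y))).
  rewrite -[X in `|_| * X]gtr0_norm ?addr_gt0// -normrM.
  have -> : (r y - r x) * (r x + r y) = (y - x) * (y + x).
    by have := sqr_r x; have := sqr_r y; nra.
  have yx : 0 < y - x by rewrite subr_gt0.
  rewrite normrM (gtr0_norm yx) ler_pM2l//.
  by apply: (le_trans (ler_normD _ _)); rewrite addrC lerD// ltW.
move=> ryx; have : `|s' * (r y - r x)| < c * (y - x).
  rewrite normrM; apply: (@le_lt_trans _ _ (`|s'| * (y - x))).
    by rewrite ler_wpM2l.
  by rewrite ltr_pM2r// subr_gt0.
by rewrite ltr_norml => /andP[]; lra.
Qed.

(** Up to the constant [ln rho], the inverse hyperbolic sine of [t / rho]. *)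
Let lnr (t : R) : R := ln (t + r t).

Let is_derive_r (t : R) : is_derive t 1 r (t / r t).
Proof.
have q0 : 0 < t ^+ 2 + rho ^+ 2 by rewrite ltr_wpDl ?sqr_ge0// exprn_gt0.
have h : is_derive t 1 (fun t : R => t ^+ 2 + rho ^+ 2) (2 * t).
  by apply: is_derive_eq; rewrite /GRing.scale/=; ring.
apply: (is_derive_eq (@is_derive1_comp R Num.sqrt _ t _ _ (is_derive1_sqrt q0) h)).
by rewrite invfM mulrACA mulVf// mul1r mulrC.
Qed.

Let is_derive_lnr (t : R) : is_derive t 1 lnr (r t)^-1.
Proof.
have h : is_derive t 1 (fun t : R => t + r t) (1 + t / r t).
  exact: is_deriveD (is_derive_id t 1) (is_derive_r t).
apply: (is_derive_eq (@is_derive1_comp R (@ln R) _ t _ _ (is_derive1_ln (rt_gt0 t)) h)).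
have := rt_gt0 t; have := r_gt0 t => ? ?; field.
by rewrite !gt_eqF.
Qed.

Local Open Scope ereal_scope.

Let mr : measurable_fun setT (fun t => (r t)^-1)%R.
Proof.
apply: measurable_invr => [|t]; last exact: sqrtr_ge0.
apply: (measurableT_comp (continuous_measurable_fun (@sqrt_continuous R))).
by apply: measurable_funD => //; exact: measurable_funX.
Qed.

Let mboost s' : measurable_fun setT (fun t : R => c * t + s' * r t)%R.
Proof.
apply: measurable_funD; apply: measurable_funM => //.
apply: (measurableT_comp (continuous_measurable_fun (@sqrt_continuous R))).
by apply: measurable_funD => //; exact: measurable_funX.
Qed.

Let integral_r a b : (a < b)%R ->
  \int[leb]_(t in `]a, b]) ((r t)^-1)%:E = (lnr b - lnr a)%R%:E.
Proof.
move=> ab; rewrite integral_itv_obnd_cbnd; last first.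
  by apply/measurable_EFinP; exact: measurable_funTS.
have cr t : {for t, continuous r}.
  by apply/differentiable_continuous/derivable1_diffP; have [] := is_derive_r t.
have cl t : {for t, continuous lnr}.
  by apply/differentiable_continuous/derivable1_diffP; have [] := is_derive_lnr t.
rewrite (@continuous_FTC2 R _ lnr)// ?EFinB//.
- apply: continuous_subspaceT => t; apply: cvgV; first by rewrite gt_eqF.
  exact: cr.
- split.
  + by move=> t _; have [] := is_derive_lnr t.
  + by apply: cvg_at_right_filter; exact: cl.
  + by apply: cvg_at_left_filter; exact: cl.
- by move=> t _; rewrite derive1E; have [_ ->] := is_derive_lnr t.
Qed.

(* In the coordinate ln (t + sqrt (t^2 + rho^2)), a primitive of the density,
   the boost is the translation by ln (c + s). *)
Lemma integral_boost (f : R -> \bar R) :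
  measurable_fun setT f -> (forall x, 0 <= f x) ->
  \int[leb]_t (((r t)^-1)%:E * f (c * t + s * r t)%R) =
  \int[leb]_t (((r t)^-1)%:E * f t).
Proof.
move=> mf f0.
have csN : (c ^+ 2 - (- s) ^+ 2 = 1)%R by rewrite sqrrN.
have norm_sN : (`|- s| < c)%R by rewrite normrN.
pose h s' t : R := (c * t + s' * r t)%R.
have hK t : h (- s)%R (h s t) = t by rewrite -[RHS](boostK t cs norm_s) /h mulNr.
have hK' t : h s (h (- s)%R t) = t.
  by rewrite -[RHS](boostK t csN norm_sN) /h /=; ring.
apply: (@ge0_integral_image R _ _ leb (fun t => (r t)^-1)%R (fun t => (r t)^-1)%R
  (h s : _ -> measurableTypeR R) f) => //.
- by move=> t; rewrite invr_ge0 ltW.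
- by move=> t; rewrite invr_ge0 ltW.
- exact: mboost.
- move=> a b ab.
  have hab : (h (- s) a < h (- s) b)%R by exact: boost_homo.
  have mono s' x y : (`|s'| < c)%R -> (h s' x < h s' y)%R = (x < y)%R.
    move=> s'c; apply/idP/idP => [|xy]; last exact: boost_homo.
    rewrite !ltNge; apply: contra; rewrite le_eqVlt => /predU1P[->//|yx].
    by apply: ltW; exact: boost_homo.
  rewrite (_ : _ @^-1` _ = `](h (- s) a)%R, (h (- s) b)%R]%classic); last first.
    have ha t : (a < h s t)%R = (h (- s) a < t)%R by rewrite -[in RHS](hK t) mono.
    have hb t : (h s t <= b)%R = (t <= h (- s) b)%R.
      by rewrite -[in RHS](hK t) !leNgt mono.
    by apply/seteqP; split => t /=; rewrite !in_itv/= ha hb.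
  rewrite !integral_r//; congr EFin.
  (* The inverse boost multiplies the light-cone coordinate [x + r x] by [c - s]; both ends of the
     interval are thus shifted by the same amount in [lnr]. *)
  have lnrE x : lnr (h (- s)%R x) = (ln (c - s) + lnr x)%R.
    rewrite /lnr -lnM ?posrE//; last by move: norm_s; rewrite ltr_norml => /andP[]; lra.
    by congr ln; rewrite /h boost_r//; ring.
  by rewrite !lnrE; ring.
- by move=> a b ab; rewrite integral_r// ltry.
Qed.

End hyperbolic_rotation.

(** * Invariance of dx/|x| under Lorentz boosts *)

Section light_cone.
Context {R : realType} (d' : nat).
Local Notation d := d'.+1.
Local Notation n := d.+1.
Local Notation leb := (@lebesgue_measure R).
Implicit Types (x phi : 'cV[R]_n) (f : 'cV[R]_n -> \bar R).

Lemma dotv0l m (y : 'cV[R]_m) : dotv 0 y = 0.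
Proof. by rewrite -(scale0r y) dotvZl mul0r. Qed.

Lemma enorm_vcons m (p : R * 'cV[R]_m) :
  enorm (vcons p) = Num.sqrt (p.1 ^+ 2 + enorm p.2 ^+ 2).
Proof. by rewrite enormE dotv_vcons -expr2 sqr_enorm. Qed.

(** The sign [eps] on the transverse coordinates is [-1] exactly when [phi] lies outside the
    ball. *)
Definition axis_boost (c s eps : R) x : 'cV[R]_n :=
  vcons (c * (vuncons x).1 + s * enorm x, eps *: (vuncons x).2).

Lemma measurable_axis_boost c s eps : measurable_fun setT (axis_boost c s eps).
Proof.
have mu1 : measurable_fun setT (fun x => (vuncons x).1).
  exact: (measurableT_comp measurable_fst (@measurable_vuncons R d)).
have mu2 : measurable_fun setT (fun x => (vuncons x).2).
  exact: (measurableT_comp measurable_snd (@measurable_vuncons R d)).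
apply: (measurableT_comp (@measurable_vcons R d)); apply: measurable_fun_pair.
  apply: measurable_funD; apply: measurable_funM => //.
  exact: measurable_enorm.
exact: measurable_scalev.
Qed.

Lemma measurable_inv_enorm m : measurable_fun setT (fun x : 'cV[R]_m => (enorm x)^-1).
Proof.
by apply: measurable_invr; [exact: measurable_enorm|exact: enorm_ge0].
Qed.

Local Open Scope ereal_scope.

Lemma integral_axis_boost c s eps f : (0 < c)%R -> (c ^+ 2 - s ^+ 2 = 1)%R ->
  (eps = 1 \/ eps = -1)%R ->
  measurable_fun setT f -> (forall x, 0 <= f x) ->
  \int[lebesgue_cV n]_x (((enorm x)^-1)%:E * f (axis_boost c s eps x)) =
  \int[lebesgue_cV n]_x (((enorm x)^-1)%:E * f x).
Proof.
move=> c0 cs eps1 mf f0.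
have inv0 m (x : 'cV[R]_m) : 0 <= ((enorm x)^-1)%:E :> \bar R.
  by rewrite lee_fin invr_ge0 enorm_ge0.
have minv : measurable_fun setT (fun x : 'cV[R]_n => ((enorm x)^-1)%:E : \bar R).
  by apply/measurable_EFinP; exact: measurable_inv_enorm.
have mfB : measurable_fun setT (fun x => ((enorm x)^-1)%:E * f (axis_boost c s eps x)).
  apply: emeasurable_funM => //.
  exact: (measurableT_comp mf (measurable_axis_boost c s eps)).
have mff : measurable_fun setT (fun x => ((enorm x)^-1)%:E * f x).
  exact: emeasurable_funM.
have mv : measurable_fun [set: measurableTypeR R * 'cV[R]_d] (@vcons R d).
  exact: measurable_vcons.
pose FB (p : measurableTypeR R * 'cV[R]_d) :=
  ((enorm (vcons p))^-1)%:E * f (axis_boost c s eps (vcons p)).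
pose Ff (p : measurableTypeR R * 'cV[R]_d) :=
  ((enorm (vcons p))^-1)%:E * f (vcons p).
have mFB : measurable_fun setT FB by exact: (measurableT_comp mfB mv).
have mFf : measurable_fun setT Ff by exact: (measurableT_comp mff mv).
have FB0 p : 0 <= FB p by rewrite mule_ge0.
have Ff0 p : 0 <= Ff p by rewrite mule_ge0.
rewrite integral_lebesgue_cVS; [|exact: mfB|by move=> x; rewrite mule_ge0].
rewrite integral_lebesgue_cVS; [|exact: mff|by move=> x; rewrite mule_ge0].
rewrite (fubini_tonelli (m1 := leb) (m2 := lebesgue_cV d) FB mFB FB0).
rewrite (fubini_tonelli (m1 := leb) (m2 := lebesgue_cV d) Ff mFf Ff0).
pose Phi v := \int[leb]_t Ff (t, v).
have mPhi : measurable_fun setT Phi.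
  exact: (measurable_fun_fubini_tonelli_G (m1 := leb) Ff mFf Ff0).
have Phi0 v : 0 <= Phi v by exact: integral_ge0.
transitivity (\int[lebesgue_cV d]_v Phi (eps *: v)%R); last first.
  case: eps1 => ->; first by apply: eq_integral => v _; rewrite scale1r.
  rewrite -[RHS](integral_lebesgue_cVN mPhi Phi0).
  by apply: eq_integral => v _; rewrite scaleN1r.
(* The axis [v = 0], where the hyperbola degenerates, is left out: it is negligible because [v]
   ranges over a space of positive dimension. *)
apply: eq_integral_off0.
- exact: (measurable_fun_fubini_tonelli_G (m1 := leb) FB mFB FB0).
- by apply: (measurableT_comp mPhi); exact: measurable_scalev.
- by move=> v; apply: integral_ge0.
- by move=> v; exact: Phi0.
move=> v v0.
have rho0 : (0 < enorm v)%R by rewrite enorm_gt0.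
have mfv : measurable_fun setT (fun t : R => f (vcons (t, eps *: v)%R)).
  apply: (measurableT_comp mf); apply: (measurableT_comp (@measurable_vcons R d)).
  exact: measurable_fun_pair.
have := integral_boost rho0 c0 cs mfv (fun t => f0 _).
rewrite /Phi /FB /Ff => E; apply: etrans (etrans _ E) _.
  by apply: eq_integral => t _; rewrite /axis_boost enorm_vcons vconsK.
apply: eq_integral => t _; rewrite enorm_vcons/= enormZ.
have -> : `|eps|%R = 1%R by case: eps1 => ->; rewrite ?normrN normr1.
by rewrite mul1r.
Qed.

Local Close Scope ereal_scope.

(* The Lorentz boost of the light cone {(|x|, x)}, whose projective action on
   the celestial sphere {|x| = 1} is the Moebius transformation. *)
Definition lorentz phi x : 'cV[R]_n :=
  Num.sg (1 - dotv phi phi) *: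
    (x + (2 * (enorm x + dotv phi x) / (1 - dotv phi phi)) *: phi).

Lemma measurable_lorentz phi : measurable_fun setT (lorentz phi).
Proof.
apply: measurable_scalev => //; apply: measurable_addv => //.
apply: measurable_scalev => //; apply: measurable_funM => //.
apply: measurable_funM => //; apply: measurable_funD; first exact: measurable_enorm.
exact: measurable_dotv.
Qed.

Let e0 : 'cV[R]_n := vcons (1, 0).

(** Half-angle formulas: for [a = tanh (theta / 2)] when [a < 1], or [a = coth (theta / 2)] when
    [a > 1], the coefficients are [cosh theta] and [sinh theta]. *)
Lemma lorentz_axis a x : 0 <= a -> a ^+ 2 != 1 ->
  lorentz (a *: e0) x =
  axis_boost ((1 + a ^+ 2) / `|1 - a ^+ 2|) (2 * a / `|1 - a ^+ 2|)
    (Num.sg (1 - a ^+ 2)) x.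
Proof.
move=> a0 a1; have a10 : 1 - a ^+ 2 != 0 by rewrite subr_eq0 eq_sym.
rewrite /lorentz /axis_boost.
have -> : dotv (a *: e0) (a *: e0) = a ^+ 2.
  by rewrite !dotvE dotv_vcons/= dotv0l addr0 !mulr1 expr2.
have -> : `|1 - a ^+ 2| = Num.sg (1 - a ^+ 2) * (1 - a ^+ 2) by rewrite normrEsg.
set q := 1 - a ^+ 2 in a10 *.
have sq : (Num.sg q)^-1 = Num.sg q.
  by rewrite /Num.sg (negbTE a10); case: ifP; rewrite ?invrN invr1.
rewrite -{1 3}(vuncons_surj x); set p := vuncons x.
have -> : dotv (a *: e0) (vcons p) = a * p.1.
  by rewrite !dotvE dotv_vcons/= mul1r dotv0l addr0.
rewrite /e0 scalerA -vconsZ/= -vconsD/= -vconsZ/= scaler0 addr0.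
congr (vcons (_, _)).
rewrite !invfM sq; move: (Num.sg q) a10 => e; rewrite /q => a10; field.
exact: a10.
Qed.

Local Open Scope ereal_scope.

Lemma integral_lorentz phi f : (dotv phi phi != 1)%R ->
  measurable_fun setT f -> (forall x, 0 <= f x) ->
  \int[lebesgue_cV n]_x (((enorm x)^-1)%:E * f (lorentz phi x)) =
  \int[lebesgue_cV n]_x (((enorm x)^-1)%:E * f x).
Proof.
move=> phi1 mf f0; set a := enorm phi.
have a0 : (0 <= a)%R by exact: enorm_ge0.
have aE : (a ^+ 2 = dotv phi phi)%R by rewrite sqr_enorm.
have e00 : dotv e0 e0 = 1%R.
  by rewrite dotv_vcons/= dotv0l addr0 mulr1.
pose H := householder (phi - a *: e0)%R.
have Hphi : H phi = (a *: e0)%R.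
  by apply: householder_swap; rewrite !dotvE e00 mulr1 -expr2 aE.
have HE x : enorm (H x) = enorm x by rewrite !enormE dotv_householder.
have mH : measurable_fun setT H by exact: measurable_householder.
have inv0 (x : 'cV[R]_n) : 0 <= ((enorm x)^-1)%:E :> \bar R.
  by rewrite lee_fin invr_ge0 enorm_ge0.
have minv : measurable_fun setT (fun x : 'cV[R]_n => ((enorm x)^-1)%:E : \bar R).
  by apply/measurable_EFinP; exact: measurable_inv_enorm.
have isoH g : measurable_fun setT g -> (forall x, 0 <= g x) ->
    \int[lebesgue_cV n]_x (((enorm x)^-1)%:E * g (H x)) =
    \int[lebesgue_cV n]_x (((enorm x)^-1)%:E * g x).
  move=> mg g0.
  rewrite -(@integral_isometry R n H (fun x => ((enorm x)^-1)%:E * g x)); last 6 first.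
  - exact: mH.
  - exact: householderD.
  - exact: householderK.
  - by move=> x; exact: dotv_householder.
  - exact: emeasurable_funM.
  - by move=> x; rewrite mule_ge0.
  by apply: eq_integral => x _; rewrite HE.
(* [lorentz] is built from norms, inner products and linear operations only, so the reflection [H]
   that exchanges [phi] and [a *: e0] conjugates one boost into the other. *)
have LH x : lorentz phi (H x) = H (lorentz (a *: e0)%R x).
  rewrite /lorentz HE.
  have -> : dotv phi (H x) = dotv (a *: e0)%R x.
    by rewrite -Hphi -[x in RHS](householderK (phi - a *: e0)%R) dotv_householder.
  have -> : dotv (a *: e0)%R (a *: e0)%R = dotv phi phi.
    by rewrite -Hphi dotv_householder.
  rewrite /H householderZ householderD householderZ -/H -Hphi.
  by rewrite [H (H _)]householderK.
rewrite -isoH; last 2 first.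
- by apply: (measurableT_comp mf); exact: measurable_lorentz.
- by move=> x; exact: f0.
have q0 : (1 - a ^+ 2 != 0)%R by rewrite aE subr_eq0 eq_sym.
rewrite -[RHS](isoH f mf f0).
rewrite -[RHS](@integral_axis_boost ((1 + a ^+ 2) / `|1 - a ^+ 2|)%R
  (2 * a / `|1 - a ^+ 2|)%R (Num.sg (1 - a ^+ 2))%R (fun x => f (H x))); last 5 first.
- by rewrite divr_gt0 ?normr_gt0// ltr_wpDr// sqr_ge0.
- rewrite !expr_div_n real_normK ?num_real//; field.
  by [].
- by rewrite /Num.sg (negbTE q0); case: ifP; [right|left].
- exact: (measurableT_comp mf mH).
- by move=> x; exact: f0.
by apply: eq_integral => x _; rewrite LH lorentz_axis ?aE.
Qed.

End light_cone.

(** * From the boost to the Möbius transformation *)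

Section mobius_sphere.
Context {R : realType} (d' : nat).
Local Notation d := d'.+1.
Local Notation n := d.+1.
Local Notation leb := (@lebesgue_measure R).
Variable phi : 'cV[R]_n.
Hypothesis phi1 : dotv phi phi != 1.
Implicit Types x y : 'cV[R]_n.

Local Notation N := (dotv phi phi).
Local Notation M := (mobius 1%:M phi).

Let N1 : 1 - N != 0. Proof. by rewrite subr_eq0 eq_sym. Qed.

Lemma mobius1E y :
  M y = ((1 - N) / dotv (y + phi) (y + phi)) *: (y + phi) + phi.
Proof. by rewrite /mobius mul1mx !sqr_enorm. Qed.

Lemma measurable_mobius1 : measurable_fun setT M.
Proof.
rewrite (_ : M = fun y => ((1 - N) / dotv (y + phi) (y + phi)) *: (y + phi) + phi);
  last by apply/funext => y; rewrite mobius1E.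
have ms : measurable_fun setT (fun y => y + phi) by exact: measurable_addv.
apply: measurable_addv => //; apply: measurable_scalev => //.
apply: measurable_funM => //; apply: measurable_invr => [|y]; last exact: dotvv_ge0.
exact: measurable_dotv.
Qed.

Lemma dotv_shift_gt0 y : dotv y y = 1 -> 0 < dotv (y + phi) (y + phi).
Proof.
move=> y1; rewrite lt0r dotvv_ge0 andbT dotvv_eq0; apply/eqP => /addr0_eq yphi.
by move: phi1; rewrite -yphi dotvNl dotvNr opprK y1 eqxx.
Qed.

Lemma dotv_mobius1 y : dotv y y = 1 -> dotv (M y) (M y) = 1.
Proof.
move=> y1; have := dotv_shift_gt0 y1; rewrite mobius1E.
set D := dotv _ _ => D0.
have DE : D = 1 + 2 * dotv y phi + N by rewrite /D !dotvE (dotvC phi y) y1; ring.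
rewrite !dotvE -/D (dotvC phi y) y1 /=.
(* Eliminating [dotv y phi] leaves a rational identity in [D] and [N] alone. *)
rewrite (_ : dotv y phi = (D - 1 - N) / 2); last by rewrite DE; field.
by field; rewrite gt_eqF.
Qed.

(** [M y - phi] is a multiple of [y + phi], with product of lengths [|1 - N|]. This moves the
    conformal factor from [y] to the image point [M y]. *)
Lemma enorm_mobius1_sub y : dotv y y = 1 ->
  enorm (M y - phi) ^+ 2 = `|1 - N| ^+ 2 / enorm (y + phi) ^+ 2.
Proof.
move=> y1; have D0 := dotv_shift_gt0 y1.
rewrite mobius1E addrK !sqr_enorm dotvZl dotvZr real_normK ?num_real//.
by field; rewrite gt_eqF.
Qed.

(** The scalar in front of [M] is positive, so rays go to rays. Without the sign in [lorentz], a
    [phi] outside the ball would give a negative multiple of [M]. *)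
Lemma lorentzE x : x != 0 ->
  lorentz phi x =
    (enorm x * (enorm (normalize x + phi) ^+ 2 / `|1 - N|)) *: M (normalize x).
Proof.
move=> x0; set y := normalize x.
have y1 : dotv y y = 1 by rewrite -sqr_enorm enorm_normalize// expr1n.
have D0 := dotv_shift_gt0 y1.
have xE : x = enorm x *: y.
  by rewrite /y /normalize scalerA divff ?scale1r// enorm_eq0.
clearbody y; rewrite mobius1E sqr_enorm /lorentz {1}xE [in dotv phi x]xE dotvZr (dotvC phi).
move: D0; set D := dotv _ _ => D0.
have DE : D = 1 + 2 * dotv y phi + N by rewrite /D !dotvE (dotvC phi y) y1; ring.
rewrite normrEsg invfM [in RHS]scalerDr !scalerA scalerDr !scalerA scalerDr -addrA -scalerDl.
have sg1 : (Num.sg (1 - N))^-1 = Num.sg (1 - N).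
  by rewrite /Num.sg (negbTE N1); case: ifP; rewrite ?invrN invr1.
rewrite sg1; congr (_ *: _ + _ *: _).
  by field; rewrite N1 gt_eqF.
rewrite (_ : dotv y phi = (D - 1 - N) / 2); last by rewrite DE; field.
by field; rewrite N1 gt_eqF.
Qed.

(** Meant for image points: at [M y] it is the reciprocal of the factor
    [enorm (y + phi) ^+ 2 / |1 - N|] of [lorentzE]. *)
Let k y := enorm (y - phi) ^+ 2 / `|1 - N|.

Let k_ge0 y : 0 <= k y.
Proof. by rewrite divr_ge0 ?sqr_ge0. Qed.

Let mk : measurable_fun setT k.
Proof.
apply: measurable_funM => //; apply: measurable_funX; apply: measurable_enormT.
exact: measurable_addv.
Qed.

Let k_gt0 y : dotv y y = 1 -> 0 < k y.
Proof.
move=> y1; rewrite divr_gt0 ?normr_gt0// exprn_gt0// enorm_gt0 subr_eq0.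
by apply/eqP => yphi; move: phi1; rewrite -yphi y1 eqxx.
Qed.

(** The second equation recovers the norm of [x] from its image, so the condition that [x] lies in
    the unit ball can be stated on the image. *)
Lemma lorentz_polar x : x != 0 ->
  normalize (lorentz phi x) = M (normalize x) /\
  enorm (lorentz phi x) * k (normalize (lorentz phi x)) = enorm x.
Proof.
move=> x0; set y := normalize x.
have y1 : dotv y y = 1 by rewrite -sqr_enorm enorm_normalize// expr1n.
have My1 : enorm (M y) = 1 by apply: eq_enorm => //; rewrite dotv_mobius1// expr1n.
have D0 : 0 < enorm (y + phi) ^+ 2 by rewrite sqr_enorm dotv_shift_gt0.
have x0' : 0 < enorm x by rewrite enorm_gt0.
have a0 : 0 < `|1 - N| by rewrite normr_gt0.
have l0 : 0 < enorm x * (enorm (y + phi) ^+ 2 / `|1 - N|).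
  by rewrite mulr_gt0// divr_gt0.
have nE : normalize (lorentz phi x) = M y.
  by rewrite lorentzE// normalizeZ// /normalize My1 invr1 scale1r.
split => //; rewrite nE lorentzE// enormZ gtr0_norm// My1 mulr1 /k.
have e0 : enorm (y + phi) != 0 by rewrite -sqrf_eq0 gt_eqF.
by rewrite enorm_mobius1_sub//; field; rewrite e0 gt_eqF.
Qed.

Local Open Scope ereal_scope.

Lemma eq_integral_sphere (f g : 'cV[R]_n -> \bar R) :
  measurable_fun setT f -> measurable_fun setT g ->
  (forall x, 0 <= f x) -> (forall x, 0 <= g x) ->
  (forall y, dotv y y = 1%R -> f y = g y) ->
  \int[surface_area]_y f y = \int[surface_area]_y g y.
Proof.
move=> mf mg f0 g0 fg; rewrite !integral_surface_area//; congr (_ * _).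
apply: eq_integral => x _; have [/andP[x0 _]|] := boolP (0 < enorm x <= 1)%R.
  by rewrite fg// -sqr_enorm enorm_normalize -?enorm_gt0// expr1n.
by move=> _; rewrite !mul0e.
Qed.

Lemma surface_area_mobius1 (A : set 'cV[R]_n) : measurable A ->
  surface_area (M @^-1` A) =
  \int[surface_area]_(y in A `&` unit_sphere)
    (((`|1 - N| / enorm (y - phi) ^+ 2) ^+ d)%R)%:E.
Proof.
move=> mA.
have mMA : measurable (M @^-1` A).
  by rewrite -[X in measurable X]setTI; exact: measurable_mobius1.
have mN := @measurable_normalize R n; have me := @measurable_enorm R n.
have mkN : measurable_fun setT (fun z => enorm z * k (normalize z))%R.
  by apply: measurable_funM => //; exact: (measurableT_comp mk mN).
have mi : measurable_fun setT (\1_A : 'cV[R]_n -> R) by exact: measurable_indic.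
(* For [z = lorentz phi x] the quantity [enorm z * k (normalize z)] is [enorm x]: [f z] tests
   whether [x] lies in the cone over the preimage of [A], and its last factor cancels the weight
   [(enorm x)^-1]. *)
pose f z : \bar R := (\1_A (normalize z) *
  (0 < enorm z * k (normalize z) <= 1)%R%:R * (enorm z * k (normalize z)))%:E.
have f0 z : 0 <= f z.
  by rewrite lee_fin !mulr_ge0 ?ler0n ?enorm_ge0.
have mf : measurable_fun setT f.
  apply/measurable_EFinP; apply: measurable_funM => //.
  apply: measurable_funM.
    exact: (measurableT_comp mi mN).
  apply: measurable_boolR; apply: measurable_and.
    exact: measurable_fun_ltr.
  exact: measurable_fun_ler.
(* This is [f z] divided by [enorm z], in the variable u = |z|^n: the quotient leaves the factor
   [k], and [enorm z * k <= 1] becomes [u * k ^+ n <= 1]. *)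
pose F (p : measurableTypeR R * 'cV[R]_n) : \bar R :=
  (\1_A p.2 * k p.2)%:E * ((0 < (p.1 : R))%R && ((p.1 : R) * k p.2 ^+ n <= 1)%R)%:R%:E.
have F0 p : 0 <= F p.
  by rewrite mule_ge0// lee_fin ?ler0n// mulr_ge0.
have mF : measurable_fun setT F.
  have mk2 : measurable_fun [set: measurableTypeR R * 'cV[R]_n] (fun p => k p.2).
    exact: (measurableT_comp mk measurable_snd).
  apply: emeasurable_funM; apply/measurable_EFinP.
    apply: measurable_funM => //.
    exact: (measurableT_comp mi measurable_snd).
  apply: measurable_boolR; apply: measurable_and.
    by apply: measurable_fun_ltr => //; exact: measurable_fst.
  apply: measurable_fun_ler => //; apply: measurable_funM; first exact: measurable_fst.
  exact: measurable_funX.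
have FN (u : R) y : (u <= 0)%R -> F (u, y) = 0.
  by rewrite leNgt /F /= => /negbTE ->; rewrite mule0.
transitivity (\int[surface_area]_y (\1_(M @^-1` A) y)%:E).
  rewrite (integral_indic _ measurableT mMA).
  by rewrite setIT.
rewrite integral_surface_area//; last exact/measurable_EFinP/measurable_indic.
transitivity (n%:R%:E * \int[lebesgue_cV n]_x (((enorm x)^-1)%:E * f (lorentz phi x))).
  congr (_ * _); apply: eq_integral => x _.
  have [->|x0] := eqVneq x 0%R.
    have -> : enorm (0%R : 'cV[R]_n) = 0%R by apply/eqP; rewrite enorm_eq0.
    by rewrite ltxx invr0 !mul0e.
  have [lN lE] := lorentz_polar x0; rewrite /f lE lN -EFinM; congr EFin.
  have : (enorm x != 0)%R by rewrite enorm_eq0.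
  have -> : \1_(M @^-1` A) (normalize x) = \1_A (M (normalize x)) :> R.
    by rewrite !indicE; congr (nat_of_bool _)%:R; apply/idP/idP; rewrite !inE.
  by move=> ?; field.
rewrite integral_lorentz//.
transitivity (n%:R%:E * \int[lebesgue_cV n]_x F ((enorm x ^+ n)%R, normalize x)).
  congr (_ * _); apply: eq_integral => z _.
  have [->|z0] := eqVneq z 0%R.
    have -> : enorm (0%R : 'cV[R]_n) = 0%R by apply/eqP; rewrite enorm_eq0.
    by rewrite FN ?expr0n// invr0 mul0e.
  have e0 : (0 < enorm z)%R by rewrite enorm_gt0.
  rewrite /f /F /= exprn_gt0// -exprMn expr_le1 ?mulr_ge0 ?enorm_ge0// pmulr_rgt0//=.
  have y1 : dotv (normalize z) (normalize z) = 1%R.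
    by rewrite -sqr_enorm enorm_normalize// expr1n.
  rewrite k_gt0//= -!EFinM; congr EFin.
  by field; rewrite gt_eqF.
rewrite -(integral_polar mF F0 FN) [RHS]integral_mkcond.
have mI : measurable (A `&` unit_sphere).
  by apply: measurableI => //; exact: measurable_unit_sphere.
apply: eq_integral_sphere.
- exact: (measurable_fun_fubini_tonelli_G (m1 := leb) F mF F0).
- apply/(measurable_restrictT _ mI); apply: measurable_funTS; apply/measurable_EFinP.
  apply: measurable_funX; apply: measurable_funM => //.
  apply: measurable_invr => [|y]; last exact: sqr_ge0.
  apply: measurable_funX; apply: measurable_enormT.
  exact: measurable_addv.
- by move=> y; apply: integral_ge0.
- by move=> y; apply: erestrict_ge0 => z _; rewrite lee_fin exprn_ge0// divr_ge0 ?sqr_ge0.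
move=> y y1; have k0 := k_gt0 y1.
rewrite patchE /F /=.
have -> : (y \in A `&` unit_sphere) = (y \in A).
  apply/idP/idP => /set_mem; first by case=> Ay _; exact: mem_set.
  move=> Ay; apply: mem_set; split => //.
  by apply: eq_enorm => //; rewrite y1 expr1n.
rewrite indicE; case: ifPn => _; last first.
  by rewrite integral0_eq// => u _; rewrite mul0r mul0e.
rewrite mul1r.
(* A constant [k y] on an interval of length [k y ^- n] integrates to [k y ^- d], the power in the
   Cauchy density. *)
transitivity (\int[leb]_(u in `]0%R, (k y ^- n)%R]) (k y)%:E).
  rewrite [RHS]integral_mkcond; apply: eq_integral => u _.
  rewrite patchE mem_setE in_itv/= -[(k y ^- n)%R]mul1r ler_pdivlMr ?exprn_gt0//.
  by case: ifP; rewrite ?mule1 ?mule0.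
rewrite integral_cst//= lebesgue_measure_itv/= lte_fin invr_gt0 exprn_gt0//.
rewrite oppr0 addr0 -EFinM exprS; congr EFin.
by rewrite invfM mulrA divff ?gt_eqF// mul1r -exprVn invf_div.
Qed.

End mobius_sphere.

Theorem corollary1 (R : realType) (d : nat) (hd : (1 <= d)%N)
    (phi : 'cV[R]_d.+1) (hphi : ~ unit_sphere phi)
    (disp : measure_display) (T : measurableType disp) (P : probability T R)
    (U : T -> 'cV[R]_d.+1) (hU : has_law P U uniform_sphere) :
  has_law P (mobius 1%:M phi \o U) (cauchy_sphere phi).
Proof.
case: d hd phi hphi U hU => [//|d'] _ phi' hphi' U' [mU UE].
have phi1 : dotv phi' phi' != 1.
  by apply/eqP => phi1; apply: hphi'; apply: eq_enorm => //; rewrite phi1 expr1n.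
split; first exact: (measurableT_comp (measurable_mobius1 phi') mU).
move=> A mA.
have mMA : measurable (mobius 1%:M phi' @^-1` A).
  by rewrite -[X in measurable X]setTI; exact: measurable_mobius1.
transitivity (pushforward P U' (mobius 1%:M phi' @^-1` A)); first by [].
rewrite (UE _ mMA) /uniform_sphere surface_area_mobius1//.
have c0 : 0 <= (fine (surface_area (@unit_sphere R d'.+2)))^-1.
  by rewrite invr_ge0 fine_ge0// measure_ge0.
rewrite -ge0_integralZl; last 4 first.
- apply: measurableI => //; exact: measurable_unit_sphere.
- apply: measurable_funTS; apply/measurable_EFinP; apply: measurable_funX.
  apply: measurable_funM => //; apply: measurable_invr => [|y]; last exact: sqr_ge0.
  apply: measurable_funX; apply: measurable_enormT; exact: measurable_addv.
- by move=> y _; rewrite lee_fin exprn_ge0// divr_ge0 ?sqr_ge0.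
- by rewrite lee_fin.
rewrite surface_area_sphere//; apply: eq_integral => y _.
by rewrite -EFinM /cauchy_density (sqr_enorm phi').
Qed.
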